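(* Let $A=KQ/I$ be a gentle algebra. (1) Let $p,q\in\mathcal{B}$ be such that $p\neq q$, $pq,qp\in I$, $s(p)=t(q)$, $s(q)=t(p)$, and $\operatorname{val}(s(p))=\operatorname{val}(s(q))=2$. For such pairs $\{p,q\}$ define $\phi_{\{p,q\}}:DA\to A$ by $p^*\mapsto q$, $q^*\mapsto -p$, and zero on the other elements of $\mathcal{B}^*$. Suppose $\operatorname{char}K\neq2$. Then the set of functions $\phi_{\{p,q\}}$ (one for each unordered pair $\{p,q\}$) is a basis of $Alt_A(DA)$. (2) Suppose $\operatorname{char}K=2$. Let $p\in\mathcal{B}\setminus Q_0$ be such that $s(p)=t(p)=e$ and $\operatorname{val}(e)=2$. For such $p$ define $\psi_{\{e,p\}}:DA\to A$ by $\psi_{\{e,p\}}(q^* )=r$ if $p=qr$ or $p=rq$ and zero otherwise ($q,r\in\mathcal{B}$), and $\psi_{\{p,p\}}:DA\to A$ by $\psi_{\{p,p\}}(p^* )=p$ and zero on the other elements of $\mathcal{B}^*$. Then the set consisting of the functions $\phi_{\{p,q\}}$ with $p,q$ as in (1), together with $\psi_{\{e,p\}}$ and $\psi_{\{p,p\}}$ with $p$ as described in (2), is a basis of $Alt_A(DA)$.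
   Context: $K$ is a field; all algebras are finite dimensional and indecomposable. Paths in a quiver are composed right to left ($ba$ means first $a$, then $b$); $s,t$ denote source and target; vertices are identified with trivial paths. A gentle algebra is $A=KQ/I$ (finite dimensional), with $Q$ a finite connected quiver, such that: (1) at each vertex at most two arrows end and at most two arrows start; (2) for every arrow $a$ there is at most one arrow $b$ with $s(a)=t(b)$ and $ab\notin I$, and at most one arrow $c$ with $s(c)=t(a)$ and $ca\notin I$; (3) for every arrow $a$ there is at most one arrow $b$ with $s(a)=t(b)$ and $ab\in I$, and at most one arrow $c$ with $s(c)=t(a)$ and $ca\in I$; (4) $I$ is generated by paths of length $2$. Standing assumption: $A$ is neither $K$ (one vertex, no arrow) nor $K[x]/(x^2)$ (one vertex, one loop). $R$ is the minimal set of paths of length $2$ generating $I$; $\mathcal{B}$ is the set of paths of $Q$ (including trivial ones) containing no element of $R$ as a subpath; it is a $K$-basis of $A$, and $\mathcal{B}^*=\{p^*:p\in\mathcal{B}\}$ is the dual basis of $DA=\operatorname{Hom}_K(A,K)$, with its usual bimodule structure $(xfy)(z)=f(yzx)$. $\operatorname{val}(v)$ is the number of arrows incident with the vertex $v$ (a loop counts twice). $Alt_A(DA)=\{\psi\in\operatorname{Hom}_{A-A}(DA,A)\mid f\psi(g)+\psi(f)g=0\text{ for all }f,g\in DA\}$, where $\operatorname{Hom}_{A-A}$ denotes $A$-bimodule homomorphisms. Exchanging $p$ and $q$ only changes $\phi_{\{p,q\}}$ by a sign; for each unordered pair an arbitrary choice of order is fixed. *)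

(* Defs.v *)
From HB Require Import structures.
From mathcomp Require Import all_boot all_algebra all_field.
From mathcomp Require Import finmap monalg.

Set Implicit Arguments.
Unset Strict Implicit.
Unset Printing Implicit Defensive.

Import GRing.Theory.
Local Open Scope ring_scope.

Record quiver := Quiver {
  vertex : finType;
  arrow : finType;
  qsrc : arrow -> vertex;
  qtgt : arrow -> vertex;
  vertex_gt0 : (0 < #|vertex|)%N
}.

Section Paths.
Variable Q : quiver.
Implicit Types (v : vertex Q) (w : seq (arrow Q)).

(* A path is a source vertex together with the word a_n ... a_1 of its arrows,
   in the order in which it is written (a_1 is traversed first). *)
Definition word_tgt v w := if w is a :: _ then qtgt a else v.

Fixpoint word_ok v w :=
  if w is a :: w' then (qsrc a == word_tgt v w') && word_ok v w' else true.

Record qpath := QPath {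
  pval : vertex Q * seq (arrow Q);
  pvalP : word_ok pval.1 pval.2
}.
HB.instance Definition _ := [isSub for pval].
HB.instance Definition _ := [Choice of qpath by <:].

Definition psrc (p : qpath) : vertex Q := (pval p).1.
Definition pword (p : qpath) : seq (arrow Q) := (pval p).2.
Definition ptgt (p : qpath) : vertex Q := word_tgt (psrc p) (pword p).
Definition plength (p : qpath) : nat := size (pword p).

Definition ptriv v : qpath := @QPath (v, [::]) isT.

Lemma parrow_ok (a : arrow Q) : word_ok (qsrc a) [:: a].
Proof. by rewrite /= eqxx. Qed.
Definition parrow (a : arrow Q) : qpath :=
  @QPath (qsrc a, [:: a]) (parrow_ok a).

(* The composite pq (first q, then p); [None] if s(p) <> t(q). *)
Definition qcomp (p q : qpath) : option qpath :=
  if psrc p == ptgt q then insub (psrc q, pword p ++ pword q) else None.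

Definition subpath (r p : qpath) : Prop :=
  exists x y xr, qcomp x r = Some xr /\ qcomp xr y = Some p.

Definition val_at v : nat :=
  #|[set a : arrow Q | qsrc a == v]| + #|[set a : arrow Q | qtgt a == v]|.

Definition adjacent : rel (vertex Q) := fun u v =>
  [exists a : arrow Q, ((qsrc a == u) && (qtgt a == v))
                    || ((qsrc a == v) && (qtgt a == u))].
Definition connected_quiver : Prop := forall u v, connect adjacent u v.

Lemma word_tgt_cat v w1 w2 :
  word_tgt v (w1 ++ w2) = word_tgt (word_tgt v w2) w1.
Proof. by case: w1. Qed.

Lemma word_ok_cat v w1 w2 :
  word_ok v (w1 ++ w2) = word_ok (word_tgt v w2) w1 && word_ok v w2.
Proof. by elim: w1 => //= a w1 ->; rewrite word_tgt_cat andbA. Qed.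

Lemma qcompP (p q r : qpath) :
  (qcomp p q = Some r) <->
  [/\ psrc p = ptgt q, psrc r = psrc q & pword r = pword p ++ pword q].
Proof.
rewrite /qcomp; split=> [|[e1 e2 e3]].
  case: eqP => // e; case: insubP => //= u _ eu [<-].
  by rewrite /psrc /pword eu.
by rewrite e1 eqxx -e2 -e3 -surjective_pairing (valK r).
Qed.

Lemma qcomp_def (p q : qpath) : psrc p = ptgt q ->
  exists2 r, qcomp p q = Some r & ptgt r = ptgt p.
Proof.
move=> e; have ok : word_ok (psrc q) (pword p ++ pword q).
  by rewrite word_ok_cat -/(ptgt q) -e /psrc /pword (pvalP p) (pvalP q).
exists (@QPath (psrc q, pword p ++ pword q) ok); first exact/qcompP.
by rewrite {1}/ptgt /psrc /pword /= word_tgt_cat -/(ptgt q) -e.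
Qed.

Lemma qpath_eq (p q : qpath) : psrc p = psrc q -> pword p = pword q -> p = q.
Proof. by move=> e1 e2; apply: val_inj; apply: injective_projections. Qed.

Lemma qcomp_None (p q : qpath) : psrc p != ptgt q -> qcomp p q = None.
Proof. by rewrite /qcomp => /negPf ->. Qed.

Lemma qcompA (p q r : qpath) :
  obind (fun x => qcomp x r) (qcomp p q) = obind (qcomp p) (qcomp q r).
Proof.
have [e1|n1] := eqVneq (psrc p) (ptgt q); last first.
  rewrite (qcomp_None n1) /=; have [e2|/qcomp_None->//] := eqVneq (psrc q) (ptgt r).
  by have [x -> tx] := qcomp_def e2; rewrite /= qcomp_None ?tx.
have [x cx tx] := qcomp_def e1; rewrite cx /=; have [_ sx wx] := (qcompP _ _ _).1 cx.
have [e2|n2] := eqVneq (psrc q) (ptgt r); last by rewrite !qcomp_None ?sx.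
have [y cy ty] := qcomp_def e2; rewrite cy /=; have [_ sy wy] := (qcompP _ _ _).1 cy.
have [u cu _] := qcomp_def (etrans sx e2).
rewrite cu; apply/esym/qcompP; have [_ -> ->] := (qcompP _ _ _).1 cu.
by rewrite ty sy wy wx catA.
Qed.

End Paths.

Definition pathAlg (K : fieldType) (Q : quiver) : Type := {malg K[qpath Q]}.

Fact malgU_scale (T : choiceType) (K : fieldType) (k : T) (c : K) :
  mkmalgU k c = c *: mkmalgU k 1 :> {malg K[T]}.
Proof. by apply/malgP => j; rewrite mcoeffZ !mcoeffU mulr_natr. Qed.

HB.instance Definition _ (K : fieldType) (Q : quiver) :=
  GRing.Zmodule.on (pathAlg K Q).

(* The scaling is that of {malg K[qpath Q]}; the locks here and below only
   keep unification fast. *)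
HB.lock Definition pathAlg_scale (K : fieldType) (Q : quiver) (c : K)
    (x : pathAlg K Q) : pathAlg K Q := c *: (x : {malg K[qpath Q]}).
Canonical pathAlg_scale_unlockable := Unlockable pathAlg_scale.unlock.

Section PathModule.
Variables (K : fieldType) (Q : quiver).
Implicit Types (x y : pathAlg K Q).

Fact pathAlg_scaleA (a b : K) x :
  pathAlg_scale a (pathAlg_scale b x) = pathAlg_scale (a * b) x.
Proof. by rewrite unlock scalerA. Qed.

Fact pathAlg_scale1 x : pathAlg_scale 1 x = x.
Proof. by rewrite unlock scale1r. Qed.

Fact pathAlg_scaleDr (a : K) x y :
  pathAlg_scale a (x + y) = pathAlg_scale a x + pathAlg_scale a y.
Proof. rewrite unlock; exact: scalerDr. Qed.

Fact pathAlg_scaleDl x (a b : K) :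
  pathAlg_scale (a + b) x = pathAlg_scale a x + pathAlg_scale b x.
Proof. rewrite unlock; exact: scalerDl. Qed.

HB.instance Definition _ :=
  GRing.Zmodule_isLmodule.Build K (pathAlg K Q) pathAlg_scaleA pathAlg_scale1
    (fun a x y => pathAlg_scaleDr a x y) pathAlg_scaleDl.

Lemma pathAlgZE (a : K) x : a *: x = a *: (x : {malg K[qpath Q]}).
Proof. by rewrite -[LHS]/(pathAlg_scale a x) unlock. Qed.

Lemma mcoeff_scale (a : K) x p : mcoeff p (a *: x) = a * mcoeff p x.
Proof. by rewrite pathAlgZE mcoeffZ. Qed.

End PathModule.

HB.lock Definition pelt (K : fieldType) (Q : quiver) (p : qpath Q) :
  pathAlg K Q := mkmalgU p 1.
Canonical pelt_unlockable := Unlockable pelt.unlock.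
Arguments pelt {K Q} p.

Definition pmul (K : fieldType) (Q : quiver) (p q : qpath Q) : pathAlg K Q :=
  oapp pelt 0 (qcomp p q).
Arguments pmul {K Q} p q.

HB.lock Definition pathAlg_mul (K : fieldType) (Q : quiver)
    (x y : pathAlg K Q) : pathAlg K Q :=
  \sum_(p <- msupp x) \sum_(q <- msupp y) (mcoeff p x * mcoeff q y) *: pmul p q.
Canonical pathAlg_mul_unlockable := Unlockable pathAlg_mul.unlock.

Section PathAlgebra.
Variables (K : fieldType) (Q : quiver).

Local Notation pathAlg_mul := (@pathAlg_mul K Q).
Definition pathAlg_one : pathAlg K Q := \sum_(v : vertex Q) pelt (ptriv v).

Lemma mcoeff_pelt p q : mcoeff q (pelt p : pathAlg K Q) = (p == q)%:R.
Proof. by rewrite unlock mcoeffU. Qed.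

Let lext (f : qpath Q -> pathAlg K Q) (x : pathAlg K Q) : pathAlg K Q :=
  \sum_(p <- msupp x) mcoeff p x *: f p.

Let lextw f x (d : {fset qpath Q}) : (msupp x `<=` d)%fset ->
  lext f x = \sum_(p <- d) mcoeff p x *: f p.
Proof.
move=> sub; rewrite /lext; apply/big_fset_incl => // p _ /mcoeff_outdom ->.
by rewrite scale0r.
Qed.

Let lext_lin f c x y : lext f (c *: x + y) = c *: lext f x + lext f y.
Proof.
pose d := (msupp x `|` msupp y)%fset.
have sx : (msupp x `<=` d)%fset by apply: fsubsetUl.
have sy : (msupp y `<=` d)%fset by apply: fsubsetUr.
have s : (msupp (c *: x + y) `<=` d)%fset.
  apply: fsubset_trans (msuppD_le _ _) _; rewrite fsubUset sy andbT.
  by rewrite pathAlgZE; apply: fsubset_trans (msuppZ_le _ _) sx.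
rewrite (lextw f sx) (lextw f sy) (lextw f s) scaler_sumr -big_split /=.
by apply: eq_bigr => p _; rewrite mcoeffD mcoeff_scale scalerDl scalerA.
Qed.

Let lext_elt f p : lext f (pelt p) = f p.
Proof.
have s : (msupp (pelt p : pathAlg K Q) `<=` [fset p])%fset.
  by rewrite unlock; exact: msuppU_le.
by rewrite (lextw f s) big_seq_fset1 mcoeff_pelt eqxx scale1r.
Qed.

Let mulE x y : pathAlg_mul x y = lext (fun p => lext (pmul p) y) x.
Proof.
rewrite unlock; apply: eq_bigr => p _; rewrite scaler_sumr.
by apply: eq_bigr => q _; rewrite scalerA.
Qed.

Lemma pathAlg_mulDZl c x y z :
  pathAlg_mul (c *: x + y) z = c *: pathAlg_mul x z + pathAlg_mul y z.
Proof. by rewrite !mulE lext_lin. Qed.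

Lemma pathAlg_mulDZr c x y z :
  pathAlg_mul x (c *: y + z) = c *: pathAlg_mul x y + pathAlg_mul x z.
Proof.
rewrite !mulE /lext scaler_sumr -big_split /=; apply: eq_bigr => p _.
by rewrite -!/(lext _ _) lext_lin scalerDr !scalerA mulrC.
Qed.

Lemma pathAlg_mul_elt p q : pathAlg_mul (pelt p) (pelt q) = pmul p q.
Proof. by rewrite mulE !lext_elt. Qed.

Lemma pathAlg_ind (P : pathAlg K Q -> Prop) :
  P 0 -> (forall p, P (pelt p)) ->
  (forall c x y, P x -> P y -> P (c *: x + y)) -> forall x, P x.
Proof.
move=> P0 P1 PD x; rewrite [x]monalgE.
elim/big_ind: _ => // [y z Py Pz|p _].
  by have := PD 1 y z Py Pz; rewrite scale1r.
have := PD (mcoeff p x) (pelt p) 0 (P1 p) P0.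
by rewrite addr0 pathAlgZE [mkmalgU _ _]malgU_scale unlock.
Qed.

Let mul0l x : pathAlg_mul 0 x = 0.
Proof.
by rewrite -[X in pathAlg_mul X _](addNr 0) -scaleN1r pathAlg_mulDZl scaleN1r addNr.
Qed.

Let mul0r x : pathAlg_mul x 0 = 0.
Proof.
by rewrite -[X in pathAlg_mul _ X](addNr 0) -scaleN1r pathAlg_mulDZr scaleN1r addNr.
Qed.

Fact pathAlg_mulZl c x y : c *: pathAlg_mul x y = pathAlg_mul (c *: x) y.
Proof.
have e := pathAlg_mulDZl c x 0 y.
by rewrite mul0l !addr0 in e; rewrite e.
Qed.

Fact pathAlg_mulZr c x y : c *: pathAlg_mul x y = pathAlg_mul x (c *: y).
Proof.
have e := pathAlg_mulDZr c x y 0.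
by rewrite mul0r !addr0 in e; rewrite e.
Qed.

Fact pathAlg_mulA : associative pathAlg_mul.
Proof.
move=> x y z; elim/pathAlg_ind: x => [|p|c x1 x2 IH1 IH2]; first by rewrite !mul0l.
  elim/pathAlg_ind: y => [|q|c x1 x2 IH1 IH2]; first by rewrite mul0r !mul0l mul0r.
    elim/pathAlg_ind: z => [|r|c x1 x2 IH1 IH2].
    - by rewrite !mul0r.
    - rewrite !pathAlg_mul_elt /pmul; have := qcompA p q r.
      case: (qcomp p q) => [x|]; case: (qcomp q r) => [y|] /=;
        rewrite ?mul0l ?mul0r ?pathAlg_mul_elt /pmul => //.
      - by move=> ->.
      - by move=> ->.
      by move=> <-.
    - by rewrite !pathAlg_mulDZr IH1 IH2.
  by rewrite !(pathAlg_mulDZr, pathAlg_mulDZl) IH1 IH2.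
by rewrite !pathAlg_mulDZl IH1 IH2.
Qed.

Fact pathAlg_mulDl : left_distributive pathAlg_mul +%R.
Proof. by move=> x y z; rewrite -[x]scale1r pathAlg_mulDZl !scale1r. Qed.

Fact pathAlg_mulDr : right_distributive pathAlg_mul +%R.
Proof. by move=> x y z; rewrite -[y]scale1r pathAlg_mulDZr !scale1r. Qed.

Let mul_suml (F : vertex Q -> pathAlg K Q) x :
  pathAlg_mul (\sum_v F v) x = \sum_v pathAlg_mul (F v) x.
Proof. exact: (big_morph (pathAlg_mul^~ x) (fun a b => pathAlg_mulDl a b x)). Qed.

Let mul_sumr (F : vertex Q -> pathAlg K Q) x :
  pathAlg_mul x (\sum_v F v) = \sum_v pathAlg_mul x (F v).
Proof. exact: (big_morph (pathAlg_mul x) (pathAlg_mulDr x)). Qed.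

Fact pathAlg_mul1l : left_id pathAlg_one pathAlg_mul.
Proof.
move=> x; elim/pathAlg_ind: x => [|p|c x y IH1 IH2]; first exact: mul0r.
  rewrite mul_suml (bigD1 (ptgt p)) //= big1 ?addr0 => [|v nv];
    rewrite pathAlg_mul_elt /pmul.
    by rewrite (_ : qcomp _ _ = Some p) //; apply/qcompP.
  by rewrite qcomp_None.
by rewrite pathAlg_mulDZr IH1 IH2.
Qed.

Fact pathAlg_mul1r : right_id pathAlg_one pathAlg_mul.
Proof.
move=> x; elim/pathAlg_ind: x => [|p|c x y IH1 IH2]; first exact: mul0l.
  rewrite mul_sumr (bigD1 (psrc p)) //= big1 ?addr0 => [|v nv];
    rewrite pathAlg_mul_elt /pmul.
    by rewrite (_ : qcomp _ _ = Some p) //; apply/qcompP; rewrite cats0.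
  by rewrite qcomp_None // eq_sym.
by rewrite pathAlg_mulDZl IH1 IH2.
Qed.

Fact pathAlg_oner_neq0 : pathAlg_one != 0.
Proof.
have /card_gt0P[v _] := vertex_gt0 Q.
apply/eqP => /(congr1 (mcoeff (ptriv v))); rewrite mcoeff0 raddf_sum /=.
rewrite (bigD1 v) //= mcoeff_pelt eqxx big1 ?addr0 => [/eqP|u nu].
  by rewrite oner_eq0.
rewrite mcoeff_pelt; case: eqP => // /(congr1 (@psrc Q)) e.
by move: nu; rewrite (e : u = v) eqxx.
Qed.

HB.instance Definition _ := GRing.Zmodule_isNzRing.Build (pathAlg K Q)
  pathAlg_mulA pathAlg_mul1l pathAlg_mul1r pathAlg_mulDl pathAlg_mulDr
  pathAlg_oner_neq0.

HB.instance Definition _ :=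
  GRing.Lmodule_isLalgebra.Build K (pathAlg K Q) pathAlg_mulZl.
HB.instance Definition _ :=
  GRing.Lalgebra_isAlgebra.Build K (pathAlg K Q) pathAlg_mulZr.

End PathAlgebra.

Section Gentle.
Variables (K : fieldType) (Q : quiver).
Implicit Types (I J : pathAlg K Q -> Prop) (R : qpath Q -> Prop).

Definition two_sided_ideal J : Prop :=
  [/\ J 0, forall x y, J x -> J y -> J (x + y)
    & forall x y z, J x -> J (y * x * z)].

Definition ideal_gen R : pathAlg K Q -> Prop := fun x =>
  forall J, two_sided_ideal J -> (forall r, R r -> J (pelt r)) -> J x.

(* [R] is a set of paths of length 2 that generates [I]. *)
Definition quadratic_gen I R : Prop :=
  (forall r, R r -> plength r = 2%N) /\ (forall x, I x <-> ideal_gen R x).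

Definition minimal_quadratic_gen I R : Prop :=
  quadratic_gen I R /\
  forall R', quadratic_gen I R' -> (forall r, R' r -> R r) ->
    forall r, R r -> R' r.

Definition arr (a : arrow Q) : pathAlg K Q := pelt (parrow a).

Definition gentle I : Prop :=
  [/\ connected_quiver Q,
      forall v, (#|[set a : arrow Q | qtgt a == v]| <= 2)%N /\
                (#|[set a : arrow Q | qsrc a == v]| <= 2)%N,
      forall a : arrow Q,
        (forall b b', qsrc a = qtgt b -> ~ I (arr a * arr b) ->
                      qsrc a = qtgt b' -> ~ I (arr a * arr b') -> b = b') /\
        (forall c c', qsrc c = qtgt a -> ~ I (arr c * arr a) ->
                      qsrc c' = qtgt a -> ~ I (arr c' * arr a) -> c = c'),
      forall a : arrow Q,
        (forall b b', qsrc a = qtgt b -> I (arr a * arr b) ->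
                      qsrc a = qtgt b' -> I (arr a * arr b') -> b = b') /\
        (forall c c', qsrc c = qtgt a -> I (arr c * arr a) ->
                      qsrc c' = qtgt a -> I (arr c' * arr a) -> c = c')
    & exists R, quadratic_gen I R].

(* A is neither K (one vertex, no arrow) nor K[x]/(x^2) (one vertex, one loop:
   for a finite dimensional gentle algebra this forces x^2 in I). *)
Definition not_degenerate : Prop :=
  ~ (#|vertex Q| = 1%N /\ (#|arrow Q| <= 1)%N).

Definition relation_free R (p : qpath Q) : Prop :=
  forall r, R r -> ~ subpath r p.

(* [pi] identifies A with KQ/I. *)
Definition presentation I (A : falgType K)
    (pi : {lrmorphism pathAlg K Q -> A}) : Prop :=
  (forall a, exists x, pi x = a) /\ (forall x, pi x = 0 <-> I x).

End Gentle.

Section DualBimodule.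
Variables (K : fieldType) (A : falgType K).

Notation DA := 'Hom(A, K^o).

(* (x f y)(z) = f(y z x) *)
Definition bimod (x : A) (f : DA) (y : A) : DA :=
  (f \o (amull y \o amulr x))%VF.

Lemma bimodE x f y z : bimod x f y z = f (y * z * x).
Proof. by rewrite !comp_lfunE !lfunE /= mulrA. Qed.

Definition bimod_hom (psi : 'Hom(DA, A)) : Prop :=
  forall x f y, psi (bimod x f y) = x * psi f * y.

Definition Alt (psi : 'Hom(DA, A)) : Prop :=
  bimod_hom psi /\
  forall f g : DA, bimod 1 f (psi g) + bimod (psi f) g 1 = 0.

End DualBimodule.

Definition is_basis (K : fieldType) (V : vectType K) (X : seq V)
    (P : V -> Prop) : Prop :=
  exists2 U : {vspace V}, (forall v, v \in U <-> P v) & basis_of U X.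

Section Maps.
Variables (K : fieldType) (Q : quiver) (A : falgType K).
Variables (pi : {lrmorphism pathAlg K Q -> A}) (B : {fset qpath Q}).
Implicit Types (b p q r : B).

Notation DA := 'Hom(A, K^o).

Definition bvec b : A := pi (pelt (val b)).

Definition btuple : #|{: B}|.-tuple A :=
  [tuple bvec (enum_val i) | i < #|{: B}|].

(* The dual basis. *)
Definition dvec b : DA := linfun (coord btuple (enum_rank b) : A -> K^o).

Definition dtuple : #|{: B}|.-tuple DA :=
  [tuple dvec (enum_val i) | i < #|{: B}|].

(* The linear map DA -> A that sends b^* to h b. *)
Definition on_dual_basis (h : B -> A) : 'Hom(DA, A) :=
  linfun (fun f : DA => \sum_b coord dtuple (enum_rank b) f *: h b).

Definition phi p q : 'Hom(DA, A) := on_dual_basis (fun b =>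
  if b == p then bvec q else if b == q then - bvec p else 0).

(* If s(p) = t(p) = e and val(e) = 2, then p passes through e only at its two
   ends, so there is at most one such r. *)
Definition psi_e p : 'Hom(DA, A) := on_dual_basis (fun b =>
  if [pick r : B | (qcomp (val b) (val r) == Some (val p))
                || (qcomp (val r) (val b) == Some (val p))]
  is Some r then bvec r else 0).

Definition psi_p p : 'Hom(DA, A) := on_dual_basis (fun b =>
  if b == p then bvec p else 0).

Lemma dvecE b x : dvec b x = coord btuple (enum_rank b) x.
Proof. by rewrite lfunE. Qed.

Lemma dvec_bvec : free btuple -> forall b c, dvec b (bvec c) = (b == c)%:R.
Proof.
move=> fB b c; have -> : bvec c = nth 0 btuple (enum_rank c).
  by rewrite -(tnth_nth 0 btuple) tnth_mktuple enum_rankK.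
by rewrite dvecE coord_free // (inj_eq enum_rank_inj) eq_sym.
Qed.

Lemma dtuple_free : free btuple -> free dtuple.
Proof.
move=> fB; apply/freeP => k sk i.
have := congr1 (fun f : DA => f (bvec (enum_val i))) sk.
rewrite /= sum_lfunE zero_lfunE (bigD1 i) //= big1 => [|j ji];
  rewrite -(tnth_nth 0 dtuple) tnth_mktuple scale_lfunE dvec_bvec //.
  by rewrite eqxx addr0 [_ *: _]mulr1.
by rewrite (inj_eq enum_val_inj) (negPf ji) scaler0.
Qed.

Lemma on_dual_basisE h b : free btuple -> on_dual_basis h (dvec b) = h b.
Proof.
move=> fB; rewrite /on_dual_basis.
pose F (f : DA) : A := \sum_c coord dtuple (enum_rank c) f *: h c.
have linF : linear F.
  move=> a f g; rewrite /F scaler_sumr -big_split /=.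
  by apply: eq_bigr => c _; rewrite linearP scalerDl scalerA.
pose lF := GRing.isLinear.Build K DA A *:%R F linF.
pose F' : {linear DA -> A} := HB.pack F lF.
rewrite -/F (lfunE F') /= /F (bigD1 b) //= big1 => [|c cb].
  have -> : dvec b = nth 0 dtuple (enum_rank b).
    by rewrite -(tnth_nth 0 dtuple) tnth_mktuple enum_rankK.
  by rewrite coord_free ?dtuple_free // eqxx scale1r addr0.
have -> : dvec b = nth 0 dtuple (enum_rank b).
  by rewrite -(tnth_nth 0 dtuple) tnth_mktuple enum_rankK.
rewrite coord_free ?dtuple_free // (inj_eq enum_rank_inj).
by rewrite eq_sym (negPf cb) scale0r.
Qed.

End Maps.

Section Pairs.
Variables (K : fieldType) (Q : quiver) (I : pathAlg K Q -> Prop).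
Variable (B : {fset qpath Q}).

Definition good_pair (p q : B) : Prop :=
  [/\ p != q, I (pelt (val p) * pelt (val q)) /\ I (pelt (val q) * pelt (val p)),
      psrc (val p) = ptgt (val q) /\ psrc (val q) = ptgt (val p)
    & val_at (psrc (val p)) = 2%N /\ val_at (psrc (val q)) = 2%N].

(* [S] contains exactly one of (p, q), (q, p) for each unordered pair. *)
Definition pair_choice (S : {set B * B}) : Prop :=
  (forall p q, (p, q) \in S -> good_pair p q) /\
  (forall p q, good_pair p q -> ((p, q) \in S) (+) ((q, p) \in S)).

Definition good_cycle (p : B) : bool :=
  [&& (0 < plength (val p))%N, psrc (val p) == ptgt (val p)
    & val_at (psrc (val p)) == 2%N].

End Pairs.

(* Main.v *)
Require Import Defs.
From mathcomp Require Import all_boot all_algebra all_field.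
From mathcomp Require Import finmap monalg.
From Stdlib Require Import Classical.

Set Implicit Arguments.
Unset Strict Implicit.
Unset Printing Implicit Defensive.

Import GRing.Theory.
Local Open Scope ring_scope.

(** A linear map [psi] from [DA] to [A] is given by its matrix [c], where [c p q]
    is the coefficient of [q] in the image under [psi] of the dual vector of
    [p].  For a bimodule map, evaluating the alternating condition at [1] shows
    that it says exactly that [c] is skew-symmetric.  Given this symmetry, right
    linearity is equivalent to left linearity, and left linearity is an equality
    between two sums of entries of [c] for all paths [x], [r], [s]: over the [p]
    with [p x = r] and over the [q] with [x q = s] ([Alt_coef]).  Paths cancel,
    so each sum has at most one term, and the equality becomes a rule for moving
    nonzero entries ([balancedP]): if [c r s] is nonzero and [r x] is a path of
    the basis, then [s = x q] for some [q], and [c (r x) q = c r s].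

    The rule leaves little room for the support of [c].  Let [c r s] be nonzero.
    Then [r] starts where [s] ends, and conversely.

    - Suppose that [r s] and [s r] both vanish in [A].  If an arrow [x] ends
      where [s] ends without being the last arrow traversed by [s], then [r x]
      is nonzero, because at most one arrow has a zero product with the arrow
      where [r] starts; by the moving rule [s] would end with [x] after all.
      Arrows leaving that vertex are treated in the same way, so both common
      endpoints of [r] and [s] have valency 2.  Either [r] and [s] are distinct
      and form one of the pairs of [phi], or they coincide, and then
      skew-symmetry allows a nonzero diagonal entry only in characteristic 2.
    - Suppose that [r s] is nonzero, a path [p] from a vertex [e] to itself.
      Moving all of [s] to the left gives [c p e = c r s].  By the moving rule
      again every arrow at [e] is an end of [p], so [e] has valency 2, unless no
      arrow meets [e] at all, which is the excluded algebra [K].  Moving [p] from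
      one side to the other gives [c p e = c e p], which together with
      skew-symmetry forces characteristic 2.

    Hence the entries at the pairs [(p, q)], at [(p, e)] and at [(p, p)]
    determine an alternating map ([coef_kernel], [alt_determined]).  The maps
    [phi], [psi_e] and [psi_p] are alternating, and evaluating these entries on
    them gives the identity matrix ([alt_entry_dual]), so they form a basis
    ([basis_of_dual_family]).

    Gentleness enters through the fact that a nonzero path extends in at most
    one way on either side, and finite dimension through the fact that no path
    of positive length has a nonzero square ([sorted_acyclic]). *)

(** * Words whose consecutive letters are related *)

Section Words.
Variables (T : eqType) (e : rel T).

Lemma sorted_cat_overlap (u v w : seq T) : v != [::] ->
  sorted e (u ++ v) -> sorted e (v ++ w) -> sorted e (u ++ v ++ w).
Proof.
case: v => // a v _; case: u => //= b u; rewrite !cat_path /= cat_path.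
by move=> /and3P[-> -> ->] /andP[_ ->].
Qed.

(** Each letter determines the next one, so two words with the same first letter
    can only differ in length. *)
Lemma sorted_prefix_total (u v : seq T) a :
  (forall x y z, e x y -> e x z -> y = z) ->
  sorted e (a :: u) -> sorted e (a :: v) ->
  prefix (a :: u) (a :: v) \/ prefix (a :: v) (a :: u).
Proof.
move=> det; elim: u v a => [|x u IH] [|y v] a; rewrite /= ?eqxx; try by [left|right].
move=> /andP[ax su] /andP[ay sv]; have xy := det _ _ _ ax ay.
by rewrite -xy in sv *; have := IH v x su sv; rewrite /= !eqxx.
Qed.

Lemma cats_inj (s t u : seq T) : s ++ t = s ++ u -> t = u.
Proof. by elim: s => //= a s IH [/IH]. Qed.

Lemma scat_inj (s t u : seq T) : t ++ s = u ++ s -> t = u.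
Proof.
by move=> /(congr1 rev); rewrite !rev_cat => /cats_inj/(can_inj (@revK T)).
Qed.

(** Only consecutive letters are tested, and those of a power of [w] already
    occur in [w ++ w]. *)
Lemma sorted_flatten_nseq (w : seq T) n : w != [::] -> sorted e (w ++ w) ->
  sorted e (flatten (nseq n w)).
Proof.
move=> w0 sw; have sw1 := (cat_sorted2 sw).1; case: n => //= n.
elim: n => [|n IH]; first by rewrite cats0.
exact: sorted_cat_overlap.
Qed.

End Words.

Lemma sorted_suffix_total (T : eqType) (e : rel T) (u v : seq T) a :
  (forall x y z, e y x -> e z x -> y = z) ->
  sorted e (rcons u a) -> sorted e (rcons v a) ->
  suffix (rcons u a) (rcons v a) \/ suffix (rcons v a) (rcons u a).
Proof.
move=> det; rewrite -[rcons u a]revK -[rcons v a]revK !rev_rcons !rev_sorted.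
rewrite !suffix_rev.
by apply: (@sorted_prefix_total _ (fun x y => e y x)) => x y z; exact: det.
Qed.

(** * Relation-free paths *)

Lemma word_ok_qpath (Q : quiver) (p : qpath Q) : word_ok (psrc p) (pword p).
Proof. exact: (pvalP p). Qed.

Lemma subpathP (Q : quiver) (r p : qpath Q) :
  subpath r p <-> exists w1 w2, pword p = w1 ++ pword r ++ w2 /\
                                psrc r = word_tgt (psrc p) w2.
Proof.
split=> [[u [v [ur [/qcompP[_ e1 e2] /qcompP[e3 e4 e5]]]]]|[w1 [w2 [ew es]]]].
  by exists (pword u), (pword v); rewrite e5 e2 catA e4 -e1 e3.
have := word_ok_qpath p; rewrite ew !word_ok_cat word_tgt_cat -es.
case/and3P=> ok1 _ ok2.
pose u : qpath Q := @QPath Q (_, w1) ok1; pose v : qpath Q := @QPath Q (_, w2) ok2.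
have [ur cur _] : exists2 ur, qcomp u r = Some ur & ptgt ur = ptgt u.
  exact: qcomp_def.
exists u, v, ur; split=> //; have [_ e1 e2] := (qcompP _ _ _).1 cur.
by apply/qcompP; split; rewrite ?e1 // e2 -catA.
Qed.

Lemma psrc_word (Q : quiver) (p : qpath Q) w a :
  pword p = rcons w a -> psrc p = qsrc a.
Proof.
move=> e; have := word_ok_qpath p.
by rewrite e -cats1 word_ok_cat /= andbT => /andP[_ /eqP].
Qed.

Section QuadraticPaths.
Variables (Q : quiver) (R : qpath Q -> Prop) (B : {fset qpath Q}).
Hypothesis size_rel : forall r, R r -> plength r = 2.
Hypothesis memB : forall p, p \in B <-> relation_free R p.

Definition nonzero_pair (a b : arrow Q) : bool :=
  oapp (fun x => x \in B) false (qcomp (parrow a) (parrow b)).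

Lemma nonzero_pair_src a b : nonzero_pair a b -> qsrc a = qtgt b.
Proof. by rewrite /nonzero_pair /qcomp; case: eqP. Qed.

Lemma mem_rfree_infix p q w1 w2 : p \in B ->
  pword p = w1 ++ pword q ++ w2 -> psrc q = word_tgt (psrc p) w2 -> q \in B.
Proof.
move=> /memB fp ew es; apply/memB => r Rr /subpathP[v1 [v2 [e1 e2]]].
apply: (fp r Rr); apply/subpathP; exists (w1 ++ v1), (v2 ++ w2).
by rewrite ew e1 -!catA e2 word_tgt_cat -es.
Qed.

(** As all relations have length 2, being relation-free is a condition on the
    consecutive arrows of a path. *)
Lemma mem_rfree_sorted p : (p \in B) = sorted nonzero_pair (pword p).
Proof.
apply/idP/idP => [pB|sp].
  suff: forall w w1, pword p = w1 ++ w -> sorted nonzero_pair w.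
    by move=> /(_ (pword p) [::]); apply.
  elim=> // a [|b w] //= IH w1 ew; rewrite (IH (rcons w1 a)) ?cat_rcons // andbT.
  have := word_ok_qpath p; rewrite ew word_ok_cat /=.
  case/and4P=> _ /eqP sa /eqP sb _; rewrite /nonzero_pair.
  have [x cx _] := @qcomp_def _ (parrow a) (parrow b) sa; rewrite cx /=.
  have [_ sx wx] := (qcompP _ _ _).1 cx.
  by apply: (mem_rfree_infix (w1 := w1) (w2 := w) pB); rewrite ?wx ?sx.
apply/memB => r Rr /subpathP[w1 [w2 [ew es]]].
have := size_rel Rr; rewrite /plength.
case er: (pword r) => [|a [|b []]] //= _.
have := sp; rewrite ew er => /cat_sorted2[_ /=/andP[ab _]].
move: ab; rewrite /nonzero_pair; case cx: (qcomp _ _) => [x|] //= xB.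
have [_ sx wx] := (qcompP _ _ _).1 cx.
have rx : r = x by apply: qpath_eq; rewrite ?wx ?er // (@psrc_word _ r [:: a] b).
have /memB/(_ _ Rr) := xB; apply; apply/subpathP; exists [::], [::].
by rewrite -rx cats0.
Qed.

Lemma rfree_word a w : sorted nonzero_pair (a :: w) ->
  exists p : B, pword (val p) = a :: w.
Proof.
move=> sw; have ok : word_ok (qsrc (last a w)) (a :: w).
  elim: w a sw => [|b w IH] a /= sw; first by rewrite eqxx.
  by case/andP: sw => /nonzero_pair_src -> /IH /= ->; rewrite eqxx.
pose p : qpath Q := @QPath Q (_, a :: w) ok.
have pB : p \in B by rewrite mem_rfree_sorted.
by exists [` pB]%fset.
Qed.

(** Otherwise all powers of [w] would be words of relation-free paths, and there
    are only finitely many such paths. *)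
Lemma sorted_acyclic w : w != [::] -> ~~ sorted nonzero_pair (w ++ w).
Proof.
move=> w0; apply/negP => sw; pose n := (\max_(p : B) size (pword (val p))).+1.
have sn := sorted_flatten_nseq n w0 sw.
have le_n : (n <= size (flatten (nseq n w)))%N.
  by rewrite size_flatten /shape map_nseq sumn_nseq leq_pmull // lt0n size_eq0.
case ew: (flatten _) sn le_n => [|a u] // /rfree_word[p ep].
by rewrite -ep ltnNge (leq_bigmax p).
Qed.

(** * The partial product of relation-free paths *)

Implicit Types (p q r x y z : B).
Definition src p := psrc (val p).
Definition tgt p := ptgt (val p).
Definition word p := pword (val p).

(** The product of two basis paths in [A]; [None] stands for 0, whether the paths
    do not compose or their composite contains a relation. *)
Definition mulB p q : option B := obind insub (qcomp (val p) (val q)).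

Lemma mulBE p q r : mulB p q = Some r <-> qcomp (val p) (val q) = Some (val r).
Proof.
rewrite /mulB; case: (qcomp _ _) => [x|] //=; split=> [|[->]]; last by rewrite valK.
by case: insubP => // u _ <- [->].
Qed.

Lemma mulBP p q r : mulB p q = Some r <->
  [/\ src p = tgt q, src r = src q & word r = word p ++ word q].
Proof. by rewrite mulBE; exact: qcompP. Qed.

Lemma tgtE p : tgt p = word_tgt (src p) (word p). Proof. by []. Qed.

Lemma mulB_tgt p q r : mulB p q = Some r -> tgt r = tgt p.
Proof. by case/mulBP=> e1 e2 e3; rewrite !tgtE e3 word_tgt_cat e2 -tgtE -e1. Qed.

Lemma B_eq p q : src p = src q -> word p = word q -> p = q.
Proof. by move=> e1 e2; apply/val_inj/qpath_eq. Qed.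

Lemma wordP p : sorted nonzero_pair (word p).
Proof. by rewrite -mem_rfree_sorted (valP p). Qed.

Lemma mulB_ex p q : src p = tgt q -> sorted nonzero_pair (word p ++ word q) ->
  exists r, mulB p q = Some r.
Proof.
move=> e s; have [x cx _] := @qcomp_def _ (val p) (val q) e.
have [_ _ wx] := (qcompP _ _ _).1 cx.
have xB : x \in B by rewrite mem_rfree_sorted wx.
by exists [` xB]%fset; apply/mulBE.
Qed.

Lemma mulB_injl x p q r : mulB p x = Some r -> mulB q x = Some r -> p = q.
Proof.
case/mulBP=> e1 e2 e3 /mulBP[f1 f2 f3]; apply: B_eq; first by rewrite e1.
by apply: (@scat_inj _ (word x)); rewrite -e3.
Qed.

Lemma mulB_injr x p q r : mulB x p = Some r -> mulB x q = Some r -> p = q.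
Proof.
case/mulBP=> e1 e2 e3 /mulBP[f1 f2 f3]; apply: B_eq; first by rewrite -e2.
by apply: (@cats_inj _ (word x)); rewrite -e3.
Qed.

Lemma vtxB_subproof v : ptriv v \in B.
Proof. by rewrite mem_rfree_sorted. Qed.
Definition vtxB v : B := [` vtxB_subproof v]%fset.

Lemma arrB_subproof a : parrow a \in B.
Proof. by rewrite mem_rfree_sorted. Qed.
Definition arrB a : B := [` arrB_subproof a]%fset.

Lemma word0 p : word p = [::] -> p = vtxB (src p).
Proof. by move=> e; apply: B_eq; rewrite ?e. Qed.

Lemma mulB1 p : mulB p (vtxB (src p)) = Some p.
Proof. by apply/mulBP; rewrite cats0. Qed.

Lemma mul1B p : mulB (vtxB (tgt p)) p = Some p.
Proof. by apply/mulBP. Qed.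

Lemma mulB_id_r p q : mulB p q = Some p -> q = vtxB (src p).
Proof. by move=> h; exact: mulB_injr h (mulB1 p). Qed.

Lemma mulB_id_l p q : mulB q p = Some p -> q = vtxB (tgt p).
Proof. by move=> h; exact: mulB_injl h (mul1B p). Qed.

Lemma src_rcons p w a : word p = rcons w a -> src p = qsrc a.
Proof. exact: psrc_word. Qed.

Lemma tgt_cons p a w : word p = a :: w -> tgt p = qtgt a.
Proof. by rewrite tgtE => ->. Qed.

End QuadraticPaths.

(** * The path basis and its dual *)

Lemma pelt_mul (K : fieldType) (Q : quiver) (p q : qpath Q) :
  pelt p * pelt q = pmul p q :> pathAlg K Q.
Proof. exact: pathAlg_mul_elt. Qed.

Section PathBasis.
Variables (K : fieldType) (Q : quiver) (I : pathAlg K Q -> Prop).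
Variables (R : qpath Q -> Prop) (A : falgType K).
Variables (pi : {lrmorphism pathAlg K Q -> A}) (B : {fset qpath Q}).
Hypothesis presI : presentation I pi.
Hypothesis genI : quadratic_gen I R.
Hypothesis memB : forall p, p \in B <-> relation_free R p.

Let size_rel := genI.1.

(** The span of the paths that contain a relation.  An inductive form is enough
    to compare it with the ideal, and it makes the ideal property an induction on
    both factors. *)
Inductive nonB_span : pathAlg K Q -> Prop :=
| NonB0 : nonB_span 0
| NonBelt p : p \notin B -> nonB_span (pelt p)
| NonBlin c x y : nonB_span x -> nonB_span y -> nonB_span (c *: x + y).

Lemma nonB_mulr x y : nonB_span x -> nonB_span (x * y).
Proof.
move=> nx; elim: nx y => [|p pB|c x1 x2 _ IH1 _ IH2] y.
- by rewrite mul0r; exact: NonB0.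
- elim/pathAlg_ind: y => [|q|c x1 x2 IH1 IH2]; first by rewrite mulr0; exact: NonB0.
    rewrite pelt_mul /pmul; case cx: (qcomp p q) => [u|] /=; last exact: NonB0.
    apply: NonBelt; apply: contra pB => uB; have [e1 e2 e3] := (qcompP _ _ _).1 cx.
    by apply: (mem_rfree_infix memB (w1 := [::]) (w2 := pword q) uB); rewrite ?e2.
  by rewrite mulrDr -scalerAr; apply: NonBlin.
by rewrite mulrDl -scalerAl; apply: NonBlin.
Qed.

Lemma nonB_mull x y : nonB_span x -> nonB_span (y * x).
Proof.
move=> nx; elim: nx y => [|p pB|c x1 x2 _ IH1 _ IH2] y.
- by rewrite mulr0; exact: NonB0.
- elim/pathAlg_ind: y => [|q|c x1 x2 IH1 IH2]; first by rewrite mul0r; exact: NonB0.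
    rewrite pelt_mul /pmul; case cx: (qcomp q p) => [u|] /=; last exact: NonB0.
    apply: NonBelt; apply: contra pB => uB; have [e1 e2 e3] := (qcompP _ _ _).1 cx.
    by apply: (mem_rfree_infix memB (w1 := pword q) (w2 := [::]) uB); rewrite ?cats0.
  by rewrite mulrDl -scalerAl; apply: NonBlin.
by rewrite mulrDr -scalerAr; apply: NonBlin.
Qed.

(** The span of the paths that contain a relation is an ideal containing the
    relations, so it contains the ideal that they generate. *)
Lemma nonB_ideal x : I x -> nonB_span x.
Proof.
move=> /genI.2; apply.
  split=> [|x1 x2 h1 h2|x1 y z h]; first exact: NonB0.
    by rewrite -[x1]scale1r; apply: NonBlin.
  exact/nonB_mulr/nonB_mull.
move=> r Rr; apply: NonBelt; apply/negP => /memB/(_ r Rr); apply.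
by apply/subpathP; exists [::], [::]; rewrite cats0.
Qed.

Lemma nonB_coeff x p : nonB_span x -> p \in B -> mcoeff p x = 0.
Proof.
move=> nx pB; elim: nx => [|q qB|c x1 x2 _ IH1 _ IH2]; first exact: mcoeff0.
  by rewrite mcoeff_pelt; case: eqP qB => // ->; rewrite pB.
by rewrite mcoeffD mcoeff_scale IH1 IH2 mulr0 addr0.
Qed.

(** A monomial ideal contains a path only if it contains one of its subpaths
    among the relations: the paths of [B] have zero coefficient on the ideal. *)
Lemma ideal_pelt p : I (pelt p) <-> p \notin B.
Proof.
split=> [/nonB_ideal h|pB].
  apply/negP => /(nonB_coeff h); rewrite mcoeff_pelt eqxx => /eqP.
  by rewrite oner_eq0.
have [r [Rr [x [y [xr [cxr cp]]]]]] : exists r, R r /\ subpath r p.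
  apply: NNPP => nr; move/negP: pB; apply; apply/memB => r Rr sr.
  by apply: nr; exists r.
have Ir : pi (pelt r) = 0 by apply/presI.2/genI.2 => J _; apply.
apply/presI.2; have -> : pelt p = pelt x * pelt r * pelt y :> pathAlg K Q.
  by rewrite !pelt_mul /pmul cxr /= pelt_mul /pmul cp.
by rewrite !rmorphM /= Ir mulr0 mul0r.
Qed.

Lemma ideal_mul_pelt (p q : B) :
  I (pelt (val p) * pelt (val q)) <-> mulB p q = None.
Proof.
rewrite pelt_mul /pmul /mulB; case: (qcomp _ _) => [x|] /=; last first.
  by split=> // _; apply/presI.2; rewrite linear0.
by rewrite ideal_pelt; case: insubP => [u ->|/negPf ->].
Qed.

(** The conditions of gentleness on pairs of arrows thus become conditions on the
    relation that defines the words of [B]. *)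
Lemma ideal_arr a b : qsrc a = qtgt b ->
  I (arr K a * arr K b) <-> ~~ nonzero_pair B a b.
Proof.
move=> ab; rewrite /arr pelt_mul /pmul /nonzero_pair.
have [x cx _] := @qcomp_def _ (parrow a) (parrow b) ab.
by rewrite cx /= ideal_pelt.
Qed.

Lemma bvec_mul (p q : B) :
  bvec pi p * bvec pi q = oapp (@bvec _ _ _ pi B) 0 (mulB p q).
Proof.
rewrite /bvec -rmorphM; case m: (mulB p q) => [r|] /=; last first.
  exact/presI.2/ideal_mul_pelt.
by move/mulBE: m; rewrite pelt_mul /pmul => ->.
Qed.

Lemma btuple_nth (b : B) : (btuple pi B)`_(enum_rank b) = bvec pi b.
Proof. by rewrite -(tnth_nth 0 (btuple pi B)) tnth_mktuple enum_rankK. Qed.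

Lemma btuple_free : free (btuple pi B).
Proof.
apply/freeP => k sk i; pose x : pathAlg K Q := \sum_j k j *: pelt (val (enum_val j)).
have Ix : I x.
  apply/presI.2; rewrite -[RHS]sk linear_sum; apply: eq_bigr => j _.
  by rewrite linearZ -(tnth_nth 0 (btuple pi B)) tnth_mktuple.
have := nonB_coeff (nonB_ideal Ix) (valP (enum_val i)).
rewrite raddf_sum (bigD1 i) //= big1 => [|j ji].
  by rewrite mcoeff_scale mcoeff_pelt eqxx mulr1 addr0.
by rewrite mcoeff_scale mcoeff_pelt (inj_eq val_inj) (inj_eq enum_val_inj)
  (negPf ji) mulr0.
Qed.

Lemma btuple_basis : basis_of fullv (btuple pi B).
Proof.
rewrite basisEfree btuple_free subvf /= -[X in (_ <= X)%N](eqnP btuple_free).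
apply/dimvS/subvP => a _; have [x <-] := presI.1 a.
elim/pathAlg_ind: x => [|p|c x y IH1 IH2]; first by rewrite linear0 mem0v.
  have [pB|] := boolP (p \in B); last first.
    by move/ideal_pelt/presI.2 => ->; rewrite mem0v.
  have -> : pi (pelt p) = bvec pi [` pB]%fset by [].
  by rewrite -btuple_nth memv_span // mem_nth // size_tuple.
by rewrite linearP memvD ?memvZ.
Qed.

Lemma bvec_expand a : a = \sum_(b : B) dvec pi b a *: bvec pi b.
Proof.
rewrite {1}(coord_basis btuple_basis (memvf a)) (reindex enum_rank) /=.
  by apply: eq_bigr => b _; rewrite btuple_nth dvecE.
by apply: onW_bij; exact: enum_rank_bij.
Qed.

Lemma dvec_delta (b c : B) : dvec pi b (bvec pi c) = (b == c)%:R.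
Proof. exact: dvec_bvec btuple_free b c. Qed.

Lemma dvec_expand (f : 'Hom(A, K^o)) :
  f = \sum_(b : B) (f (bvec pi b) : K) *: dvec pi b.
Proof.
apply/lfunP => a; rewrite {1}(bvec_expand a) linear_sum sum_lfunE.
by apply: eq_bigr => b _; rewrite linearZ scale_lfunE; exact: mulrC.
Qed.

Lemma dvec_sep a a' : (forall b : B, dvec pi b a = dvec pi b a') -> a = a'.
Proof.
by move=> e; rewrite (bvec_expand a) (bvec_expand a'); apply: eq_bigr => b _; rewrite e.
Qed.

End PathBasis.

(** * Alternating maps in coordinates *)

(** Left linearity in coordinates: for [c] the matrix of a map [psi], the two sides
    are the coefficients of [s] in the image under [psi] of the product of [x] and
    the dual vector of [r], and in the product of [x] and the image of that dual
    vector. *)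
Definition balanced (K : fieldType) (Q : quiver) (B : {fset qpath Q})
    (c : B -> B -> K) : Prop :=
  forall x r s : B,
    \sum_(p : B) (mulB p x == Some r)%:R * c p s
    = \sum_(q : B) (mulB x q == Some s)%:R * c r q.

Definition skewsym (K : fieldType) (T : Type) (c : T -> T -> K) : Prop :=
  forall p q, c p q = - c q p.

Section BimoduleLinear.
Variables (K : fieldType) (A : falgType K).
Local Notation DA := 'Hom(A, K^o).

Lemma bimod_sumZl (T : finType) (k : T -> K) (x : T -> A) (f : DA) y :
  bimod (\sum_i k i *: x i) f y = \sum_i k i *: bimod (x i) f y.
Proof.
apply/lfunP => z; rewrite bimodE mulr_sumr linear_sum sum_lfunE.
by apply: eq_bigr => i _; rewrite -scalerAr linearZ scale_lfunE bimodE.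
Qed.

Lemma bimod_sumZf (T : finType) (k : T -> K) x (f : T -> DA) y :
  bimod x (\sum_i k i *: f i) y = \sum_i k i *: bimod x (f i) y.
Proof.
apply/lfunP => z; rewrite bimodE !sum_lfunE.
by apply: eq_bigr => i _; rewrite !scale_lfunE bimodE.
Qed.

Lemma bimod_bimod x (f : DA) y : bimod x f y = bimod x (bimod 1 f y) 1.
Proof. by apply/lfunP => z; rewrite !bimodE mul1r mulr1 mulrA. Qed.

End BimoduleLinear.

Section Coefficients.
Variables (K : fieldType) (Q : quiver) (I : pathAlg K Q -> Prop).
Variables (R : qpath Q -> Prop) (A : falgType K).
Variables (pi : {lrmorphism pathAlg K Q -> A}) (B : {fset qpath Q}).
Hypothesis presI : presentation I pi.
Hypothesis genI : quadratic_gen I R.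
Hypothesis memB : forall p, p \in B <-> relation_free R p.

Local Notation DA := 'Hom(A, K^o).
Implicit Types (psi : 'Hom(DA, A)) (p q r s x y : B) (f g : DA).

Let delta := dvec_delta presI genI memB.

Definition coef psi p q : K := dvec pi q (psi (dvec pi p)).

Lemma coef_linear a psi psi' p q :
  coef (a *: psi + psi') p q = a * coef psi p q + coef psi' p q.
Proof. by rewrite /coef add_lfunE scale_lfunE linearP. Qed.

Lemma coef_on_dual_basis h p q :
  coef (on_dual_basis pi h) p q = dvec pi q (h p).
Proof. by rewrite /coef on_dual_basisE //; exact: btuple_free genI memB. Qed.

Lemma coef_eq0 psi : (forall p q, coef psi p q = 0) -> psi = 0.
Proof.
move=> c0; apply/lfunP => f; rewrite (dvec_expand presI genI memB f) linear_sum.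
rewrite zero_lfunE; apply: big1 => p _; rewrite linearZ /=.
suff -> : psi (dvec pi p) = 0 by rewrite scaler0.
by apply: (dvec_sep presI genI memB) => q; rewrite linear0; exact: c0.
Qed.

Lemma bimod_bvec_dvec x r : bimod (bvec pi x) (dvec pi r) 1
  = \sum_p (mulB p x == Some r)%:R *: dvec pi p.
Proof.
rewrite [LHS](dvec_expand presI genI memB); apply: eq_bigr => p _.
rewrite bimodE mul1r (bvec_mul presI genI memB); congr (_ *: _).
by case: (mulB p x) => [y|]; rewrite /= ?linear0 // delta eq_sym.
Qed.

Lemma dvec_bvec_mul x s a : dvec pi s (bvec pi x * a)
  = \sum_q (mulB x q == Some s)%:R * dvec pi q a.
Proof.
rewrite {1}(bvec_expand presI genI memB a) mulr_sumr linear_sum.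
apply: eq_bigr => q _; rewrite -scalerAr linearZ (bvec_mul presI genI memB) mulrC.
congr (_ * _); case: (mulB x q) => [y|]; rewrite /= ?linear0 //.
by rewrite delta eq_sym.
Qed.

(** Skew-symmetry exchanges the two arguments of the bilinear form [f (psi g)], and
    this turns left multiplications into right ones.  So it suffices to impose left
    linearity, and the alternating condition need only be tested at [1]. *)
Lemma Alt_coef psi : Alt psi <-> skewsym (coef psi) /\ balanced (coef psi).
Proof.
split=> [[hom alt]|[sk bal]].
  split=> [p q|x r s].
    have := congr1 (fun f : DA => f 1) (alt (dvec pi q) (dvec pi p)).
    rewrite add_lfunE !bimodE zero_lfunE !mulr1 mul1r.
    by move/eqP; rewrite addr_eq0 => /eqP.
  have := congr1 (dvec pi s) (hom (bvec pi x) (dvec pi r) 1).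
  rewrite mulr1 dvec_bvec_mul bimod_bvec_dvec !linear_sum /= => <-.
  by apply: eq_bigr => p _; rewrite !linearZ.
have left_hom (x : A) f : psi (bimod x f 1) = x * psi f.
  apply: (dvec_sep presI genI memB) => s.
  rewrite {1}(dvec_expand presI genI memB f) (bvec_expand presI genI memB x).
  rewrite bimod_sumZl mulr_suml !linear_sum; apply: eq_bigr => y _.
  rewrite bimod_sumZf -scalerAl !linearZ; congr (_ *: _).
  rewrite /= dvec_bvec_mul [in RHS](dvec_expand presI genI memB f) !linear_sum /=.
  under [RHS]eq_bigr => q _ do rewrite !linear_sum /= mulr_sumr.
  rewrite [RHS]exchange_big; apply: eq_bigr => r _.
  under [RHS]eq_bigr => q _ do rewrite !linearZ /= mulrCA.
  rewrite -mulr_sumr -(bal y r s) bimod_bvec_dvec !linearZ /=.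
  apply: (congr1 ( *%R _)); rewrite !linear_sum; apply: eq_bigr => p _.
  by rewrite !linearZ.
have sk_form f g : f (psi g) = - g (psi f).
  rewrite [in RHS](dvec_expand presI genI memB f) !linear_sum /=.
  rewrite [in LHS](dvec_expand presI genI memB f) sum_lfunE; apply: eq_bigr => p _.
  rewrite scale_lfunE !linearZ /=; congr (_ *: _).
  rewrite [in RHS](dvec_expand presI genI memB g) sum_lfunE -sumrN.
  rewrite [in LHS](dvec_expand presI genI memB g) !linear_sum /=.
  apply: eq_bigr => q _; rewrite scale_lfunE -scalerN !linearZ; congr (_ *: _).
  exact: sk.
have right_hom f (y : A) : psi (bimod 1 f y) = psi f * y.
  apply: (dvec_sep presI genI memB) => s.
  rewrite sk_form bimodE mulr1 -left_hom -sk_form bimodE.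
  by rewrite mul1r.
split=> [x f y|f g]; first by rewrite bimod_bimod left_hom right_hom mulrA.
apply/lfunP => z; rewrite add_lfunE !bimodE zero_lfunE mulr1 mul1r.
by rewrite -left_hom (sk_form g) bimodE mul1r addrN.
Qed.

End Coefficients.

(** * Moving a path between the two arguments *)

(** With one arrow entering and one leaving, valency 2 leaves no room for another
    arrow; a loop may take both parts. *)
Lemma val_at2P (Q : quiver) (v : vertex Q) (a b : arrow Q) :
  qtgt a = v -> qsrc b = v ->
  val_at v = 2 <-> (forall x, qtgt x = v -> x = a) /\ (forall x, qsrc x = v -> x = b).
Proof.
move=> ta sb; rewrite /val_at.
have out_gt0 : (0 < #|[set x : arrow Q | qsrc x == v]|)%N.
  by apply/card_gt0P; exists b; rewrite inE sb.
have in_gt0 : (0 < #|[set x : arrow Q | qtgt x == v]|)%N.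
  by apply/card_gt0P; exists a; rewrite inE ta.
split=> [e|[ua ub]].
  have /cards1P[b' eb] : #|[set x : arrow Q | qsrc x == v]| == 1%N.
    by move: out_gt0 in_gt0 e; case: #|_| => [|[|m]] //; case: #|_| => [|n] // _ _;
      rewrite addnS addSn.
  have /cards1P[a' ea] : #|[set x : arrow Q | qtgt x == v]| == 1%N.
    by move: e; rewrite eb cards1 => /eqP; rewrite (eqn_add2l 1 _ 1).
  have oneb x : qsrc x = v -> x = b' by move=> sx; apply/set1P; rewrite -eb inE sx.
  have onea x : qtgt x = v -> x = a' by move=> tx; apply/set1P; rewrite -ea inE tx.
  by split=> x hx; [rewrite (onea x) // (onea a) | rewrite (oneb x) // (oneb b)].
have -> : [set x | qsrc x == v] = [set b].
  by apply/setP=> x; rewrite !inE; apply/eqP/eqP => [/ub|->].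
have -> : [set x | qtgt x == v] = [set a].
  by apply/setP=> x; rewrite !inE; apply/eqP/eqP => [/ua|->].
by rewrite !cards1.
Qed.

Section Movable.
Variables (K : fieldType) (Q : quiver) (B : {fset qpath Q}).
Implicit Types (p q r s x y z : B) (c : B -> B -> K).

Lemma sum_mulBl p x r (F : B -> K) : mulB p x = Some r ->
  \sum_(p' : B) (mulB p' x == Some r)%:R * F p' = F p.
Proof.
move=> m; rewrite (bigD1 p) //= m eqxx mul1r big1 ?addr0 // => p' np.
case: eqP => [m'|_]; last by rewrite mul0r.
by rewrite (mulB_injl m' m) eqxx in np.
Qed.

Lemma sum_mulBr q x s (F : B -> K) : mulB x q = Some s ->
  \sum_(q' : B) (mulB x q' == Some s)%:R * F q' = F q.
Proof.
move=> m; rewrite (bigD1 q) //= m eqxx mul1r big1 ?addr0 // => q' nq.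
case: eqP => [m'|_]; last by rewrite mul0r.
by rewrite (mulB_injr m' m) eqxx in nq.
Qed.

(** The form in which left linearity is used: a nonzero entry stays the same when
    a path passes from one argument to the other. *)
Definition movable c : Prop :=
  (forall p x r s, mulB p x = Some r -> c p s != 0 ->
     exists2 q, mulB x q = Some s & c r q = c p s) /\
  (forall x q r s, mulB x q = Some s -> c r q != 0 ->
     exists2 p, mulB p x = Some r & c p s = c r q).

(** Paths cancel on both sides, so each of the two sums has at most one term. *)
Lemma balancedP c : balanced c <-> movable c.
Proof.
split=> [bal|[mvl mvr] x r s].
  split=> [p x r s m|x q r s m].
    have := bal x r s; rewrite (sum_mulBl _ m) => -> nz.
    have [q /eqP mq|no] := pickP (fun q => mulB x q == Some s).
      by exists q; rewrite // (sum_mulBr _ mq).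
    by rewrite big1 ?eqxx // in nz => q _; rewrite no mul0r.
  have := bal x r s; rewrite (sum_mulBr _ m) => <- nz.
  have [p /eqP mp|no] := pickP (fun p => mulB p x == Some r).
    by exists p; rewrite // (sum_mulBl _ mp).
  by rewrite big1 ?eqxx // in nz => p _; rewrite no mul0r.
have [p /eqP mp|nop] := pickP (fun p => mulB p x == Some r).
  rewrite (sum_mulBl _ mp); have [c0|/(mvl _ _ _ _ mp)[q mq <-]] := eqVneq (c p s) 0.
    rewrite c0 big1 // => q _; case: eqP => [mq|_]; last by rewrite mul0r.
    rewrite mul1r; apply/eqP; apply: contraT => nz.
    have [p' mp' e] := mvr _ _ _ _ mq nz.
    by rewrite -e -(mulB_injl mp mp') c0 eqxx in nz.
  by rewrite (sum_mulBr _ mq).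
rewrite big1 => [|p _]; last by rewrite nop mul0r.
apply/esym/big1 => q _; case: eqP => [mq|_]; last by rewrite mul0r.
rewrite mul1r; apply/eqP; apply: contraT => /(mvr _ _ _ _ mq)[p mp _].
by move: (nop p); rewrite mp eqxx.
Qed.

End Movable.

(** * The first and the last arrow of a path *)

Section PathEnds.
Variables (Q : quiver) (R : qpath Q -> Prop) (B : {fset qpath Q}).
Hypothesis size_rel : forall r, R r -> plength r = 2.
Hypothesis memB : forall p, p \in B <-> relation_free R p.
Implicit Types (p q r s x y z : B) (a b h l : arrow Q).

Local Notation nzp := (nonzero_pair B).
Local Notation vtx := (vtxB size_rel memB).
Local Notation arr1 := (arrB size_rel memB).

(** Words are written with the arrow traversed first on the right: [head_arrow] is
    the arrow that enters the target, and [last_arrow] the one that leaves the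
    source. *)
Definition head_arrow p := ohead (word p).
Definition last_arrow p := ohead (rev (word p)).

Lemma head_arrowP p h :
  head_arrow p = Some h <-> exists w, word p = h :: w.
Proof.
rewrite /head_arrow; case: (word p) => [|a w] /=; first by split=> [|[]].
by split=> [[->]|[u [->]]] //; exists w.
Qed.

Lemma last_arrowP p l :
  last_arrow p = Some l <-> exists w, word p = rcons w l.
Proof.
rewrite /last_arrow; case/lastP: (word p) => [|w a]; first by split=> [|[[]]].
rewrite rev_rcons /=; split=> [[->]|[u /rcons_inj[_ ->]]] //; by exists w.
Qed.

Lemma head_arrow_tgt p h : head_arrow p = Some h -> qtgt h = tgt p.
Proof. by case/head_arrowP=> w e; rewrite (tgt_cons e). Qed.

Lemma last_arrow_src p l : last_arrow p = Some l -> qsrc l = src p.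
Proof. by case/last_arrowP=> w e; rewrite (src_rcons e). Qed.

Lemma path_ends p : word p = [::] \/
  exists h l, head_arrow p = Some h /\ last_arrow p = Some l.
Proof.
rewrite /head_arrow /last_arrow; case/lastP ew: (word p) => [|w l]; first by left.
right; rewrite rev_rcons; case: w ew => [|h w] _; first by exists l, l.
by exists h, l.
Qed.

Lemma head_arrow_mul a q s : mulB (arr1 a) q = Some s -> head_arrow s = Some a.
Proof. by case/mulBP=> _ _ e; rewrite /head_arrow e. Qed.

Lemma last_arrow_mul a p r : mulB p (arr1 a) = Some r -> last_arrow r = Some a.
Proof. by case/mulBP=> _ _ e; rewrite /last_arrow e rev_cat. Qed.

Lemma head_arrow_arr a : head_arrow (arr1 a) = Some a. Proof. by []. Qed.
Lemma last_arrow_arr a : last_arrow (arr1 a) = Some a. Proof. by []. Qed.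

(** The relations have length 2, so a product can only vanish at the junction. *)
Lemma mulB_junction p q l h : last_arrow p = Some l -> head_arrow q = Some h ->
  isSome (mulB p q) = nzp l h.
Proof.
move=> lp hq; have [u eu] := (last_arrowP _ _).1 lp.
have [v ev] := (head_arrowP _ _).1 hq; have sp := wordP size_rel memB p.
have sq := wordP size_rel memB q; rewrite eu in sp; rewrite ev in sq.
have glue : sorted nzp (word p ++ word q) = nzp l h.
  by rewrite eu ev cat_rcons sorted_cat_cons sp /= (sq : path nzp h v) andbT.
apply/idP/idP => [|lh].
  case m: (mulB p q) => [r|] // _; rewrite -glue.
  by have [_ _ <-] := (mulBP _ _ _).1 m; exact: wordP size_rel memB r.
have spq : src p = tgt q.
  by rewrite -(last_arrow_src lp) -(head_arrow_tgt hq) (nonzero_pair_src lh).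
by have [|r ->] := mulB_ex size_rel memB spq; rewrite ?glue.
Qed.

Lemma mulB_split p w1 w2 : word p = w1 ++ w2 ->
  exists z1 z2, [/\ mulB z1 z2 = Some p, word z1 = w1 & word z2 = w2].
Proof.
move=> e; have := word_ok_qpath (val p); rewrite -/(word p) -/(src p) e word_ok_cat.
case/andP=> ok1 ok2; have sp := wordP size_rel memB p.
rewrite e in sp; have [s1 s2] := cat_sorted2 sp.
pose y2 : qpath Q := @QPath Q (_, w2) ok2; pose y1 : qpath Q := @QPath Q (_, w1) ok1.
have B2 : y2 \in B by rewrite (mem_rfree_sorted size_rel memB).
have B1 : y1 \in B by rewrite (mem_rfree_sorted size_rel memB).
by exists [` B1]%fset, [` B2]%fset; split=> //; apply/mulBP.
Qed.

Lemma word_inj p q : word p != [::] -> word p = word q -> p = q.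
Proof.
move=> n e; apply: B_eq => //; case/lastP ep: (word p) n => [|w a] // _.
by rewrite (src_rcons ep) (@src_rcons _ _ q w a) // -e.
Qed.

Lemma mulB_cancel_l u x z s p r : mulB u s = Some p -> mulB r z = Some p ->
  mulB u x = Some r -> mulB x z = Some s.
Proof.
case/mulBP=> e1 e2 e3 /mulBP[f1 f2 f3] /mulBP[g1 g2 g3]; apply/mulBP.
split; first by rewrite -g2.
  by rewrite -e2.
by apply: (@cats_inj _ (word u)); rewrite -e3 f3 g3 catA.
Qed.

Lemma mulB_cancel_r u x z r p s : mulB r u = Some p -> mulB z s = Some p ->
  mulB x u = Some s -> mulB z x = Some r.
Proof.
case/mulBP=> e1 e2 e3 /mulBP[f1 f2 f3] xu.
have tx := mulB_tgt xu; case/mulBP: xu => g1 g2 g3; apply/mulBP.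
split; [by rewrite f1 | by rewrite g1|].
by apply: (@scat_inj _ (word u)); rewrite -e3 f3 g3 catA.
Qed.

Lemma mulB_trivr p q r : mulB p q = Some r -> word q = [::] ->
  p = r /\ q = vtx (src r).
Proof.
move=> m q0; rewrite (word0 size_rel memB q0) in m *.
have [e1 e2 e3] := (mulBP _ _ _).1 m.
split; last by rewrite e2.
by apply: B_eq; rewrite ?e3 ?cats0 // e1 e2.
Qed.

Lemma mulB_trivl p q r : mulB p q = Some r -> word p = [::] ->
  q = r /\ p = vtx (tgt r).
Proof.
move=> m p0; have tr := mulB_tgt m; have [e1 e2 e3] := (mulBP _ _ _).1 m.
split; first by apply: B_eq; rewrite ?e3 ?p0.
by rewrite (word0 size_rel memB p0) tr tgtE p0.
Qed.

End PathEnds.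

(** * Cycles and vanishing products in a gentle quiver *)

Section GentleCombinatorics.
Variables (Q : quiver) (R : qpath Q -> Prop) (B : {fset qpath Q}).
Hypothesis size_rel : forall r, R r -> plength r = 2.
Hypothesis memB : forall p, p \in B <-> relation_free R p.
Implicit Types (p q r s x y z : B) (a b h l : arrow Q).

Local Notation nzp := (nonzero_pair B).
Local Notation vtx := (vtxB size_rel memB).
Local Notation arr1 := (arrB size_rel memB).

Hypothesis nz_next : forall a b b', nzp a b -> nzp a b' -> b = b'.
Hypothesis nz_prev : forall a b b', nzp b a -> nzp b' a -> b = b'.
Hypothesis rel_next : forall a b b', qsrc a = qtgt b -> ~~ nzp a b ->
  qsrc a = qtgt b' -> ~~ nzp a b' -> b = b'.
Hypothesis rel_prev : forall a b b', qsrc b = qtgt a -> ~~ nzp b a ->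
  qsrc b' = qtgt a -> ~~ nzp b' a -> b = b'.

Definition cyclic p : Prop :=
  [/\ word p != [::], src p = tgt p & val_at (src p) = 2].

Lemma cyclic_ends p : cyclic p -> exists h l,
  [/\ head_arrow p = Some h, last_arrow p = Some l,
      (forall a, qtgt a = src p -> a = h) /\ (forall a, qsrc a = src p -> a = l)
    & ~~ nzp l h].
Proof.
case=> np cp vp; have [e0|[h [l [hp lp]]]] := path_ends p; first by rewrite e0 in np.
exists h, l; split=> //.
  by apply/(val_at2P _ _).1; rewrite ?(head_arrow_tgt hp) ?(last_arrow_src lp).
rewrite -(mulB_junction size_rel memB lp hp); case m: (mulB p p) => [r|] //.
have [_ _ e] := (mulBP _ _ _).1 m; have := wordP size_rel memB r.
by rewrite e (negPf (sorted_acyclic size_rel memB np)).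
Qed.

(** At a vertex of valency 2 a path can only enter by the end of [p] and leave by
    its beginning, so a path through that vertex would make the square of [p]
    nonzero. *)
Lemma cyclic_pass p x y : cyclic p -> word y != [::] -> word x != [::] ->
  src y = src p -> tgt x = src p -> mulB y x = None.
Proof.
move=> /cyclic_ends[h [l [hp lp [inh outl] nlh]]] ny nx sy tx.
have [ey|[_ [ly [_ hly]]]] := path_ends y; first by rewrite ey in ny.
have [ex|[hx [_ [hhx _]]]] := path_ends x; first by rewrite ex in nx.
have := mulB_junction size_rel memB hly hhx.
rewrite (outl ly) ?(last_arrow_src hly) // (inh hx) ?(head_arrow_tgt hhx) //.
by rewrite (negPf nlh); case: (mulB y x).
Qed.

(** A path that enters the vertex of [p] does so by the same arrow as [p].  As
    arrows have at most one nonzero extension, one of the two paths is a left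
    factor of the other, and [p] cannot be the shorter one since it cannot be
    prolonged through its vertex. *)
Lemma cyclic_left_factor p y : cyclic p -> tgt y = src p ->
  exists z, mulB y z = Some p.
Proof.
move=> cp ty; have [np ep _] := cp; have [h [l [hp lp [inh _] _]]] := cyclic_ends cp.
have [y0|[hy [_ [hhy _]]]] := path_ends y.
  exists p; rewrite (word0 size_rel memB y0) -[RHS](mul1B size_rel memB p).
  by rewrite -ep -ty tgtE y0.
have ehy : hy = h by apply: inh; rewrite (head_arrow_tgt hhy).
have [u eu] := (head_arrowP _ _).1 hp; have [v ev] := (head_arrowP _ _).1 hhy.
have sp := wordP size_rel memB p; have sy := wordP size_rel memB y.
have ny : word y != [::] by rewrite ev.
rewrite ehy in ev; rewrite eu in sp; rewrite ev in sy.
case: (sorted_prefix_total nz_next sp sy); rewrite -eu -ev.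
  case/prefixP=> [[|a w]] e.
    exists (vtx (src p)); rewrite cats0 in e; rewrite (word_inj ny e).
    exact: mulB1.
  have [z1 [z2 [m w1 w2]]] := mulB_split size_rel memB e.
  rewrite (word_inj np (esym w1)) in cp ep *.
  have [_ sz _] := cp; have [e1 _ _] := (mulBP _ _ _).1 m.
  by rewrite (cyclic_pass cp) ?w1 ?w2 // in m; rewrite -?e1.
case/prefixP=> w e; have [z1 [z2 [m w1 w2]]] := mulB_split size_rel memB e.
by exists z2; rewrite (word_inj ny (esym w1)).
Qed.

Lemma cyclic_right_factor p y : cyclic p -> src y = src p ->
  exists z, mulB z y = Some p.
Proof.
move=> cp ty; have [np ep _] := cp; have [h [l [hp lp [_ outl] _]]] := cyclic_ends cp.
have [y0|[_ [ly [_ lly]]]] := path_ends y.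
  exists p; rewrite (word0 size_rel memB y0) -[RHS](mulB1 size_rel memB p).
  by rewrite ty.
have ely : ly = l by apply: outl; rewrite (last_arrow_src lly).
have [u eu] := (last_arrowP _ _).1 lp; have [v ev] := (last_arrowP _ _).1 lly.
have sp := wordP size_rel memB p; have sy := wordP size_rel memB y.
have ny : word y != [::] by rewrite ev; case: (v).
rewrite ely in ev; rewrite eu in sp; rewrite ev in sy.
case: (sorted_suffix_total nz_prev sp sy); rewrite -eu -ev.
  case/suffixP=> w e; have [z1 [z2 [m w1 w2]]] := mulB_split size_rel memB e.
  have [e0|nw] := eqVneq w [::].
    exists (vtx (tgt p)); rewrite e0 in e; rewrite (word_inj ny e).
    exact: mul1B.
  rewrite (word_inj np (esym w2)) in cp ep *.
  have [_ sz _] := cp; have [e1 _ _] := (mulBP _ _ _).1 m.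
  by rewrite (cyclic_pass cp) ?w1 ?w2 // in m; rewrite e1 sz.
case/suffixP=> w e; have [z1 [z2 [m w1 w2]]] := mulB_split size_rel memB e.
by exists z1; rewrite (word_inj ny (esym w2)).
Qed.

(** The support of [psi_e]: the ways to cut the cycle [p] into two pieces, in
    either order. *)
Definition cuts p q r : bool := (mulB q r == Some p) || (mulB r q == Some p).

Lemma cutsC p q r : cuts p q r = cuts p r q.
Proof. exact: orbC. Qed.

(** This is what makes the choice in the definition of [psi_e] harmless. *)
Lemma cuts_functional p q r s : cyclic p -> cuts p q r -> cuts p q s -> r = s.
Proof.
have opposite x y z : cyclic p -> mulB x y = Some p -> mulB z x = Some p -> y = z.
  move=> cp xy zx; have [np ep _] := cp.
  have [e1 e2 _] := (mulBP _ _ _).1 xy; have tx := mulB_tgt xy.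
  have [f1 f2 _] := (mulBP _ _ _).1 zx.
  have [y0|ny] := eqVneq (word y) [::].
    have [xp ->] := mulB_trivr size_rel memB xy y0; rewrite xp in zx.
    by rewrite (mulB_id_l size_rel memB zx) ep.
  have [x0|nx] := eqVneq (word x) [::].
    have [-> _] := mulB_trivl size_rel memB xy x0.
    by have [-> _] := mulB_trivr size_rel memB zx x0.
  by rewrite (cyclic_pass cp nx ny) // -?e1 -?f2 in xy.
move=> cp /orP[/eqP qr|/eqP rq] /orP[/eqP qs|/eqP sq].
- exact: mulB_injr qr qs.
- exact: opposite cp qr sq.
- exact/esym/(opposite _ _ _ cp qs rq).
- exact: mulB_injl rq sq.
Qed.

(** Let [x] be moved across a cut of [p].  If the cut is at a vertex inside [p],
    then both [x] and the piece that it leaves are read along [p], so the result is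
    a cut again; [cyclic_left_factor] and [cyclic_right_factor] provide the other
    piece.  For the opposite order of the pieces the junction with [x] is at the vertex
    of valency 2, through which no nonzero path passes, so one factor is trivial. *)
Lemma cuts_movable (K : fieldType) p : cyclic p ->
  movable (fun q r => (cuts p q r)%:R : K).
Proof.
move=> cp; have [np ep _] := cp.
have cuts_nz q r : ((cuts p q r)%:R != 0 :> K) -> cuts p q r.
  by case: (cuts p q r); rewrite ?eqxx.
have via_left u x r s : mulB u x = Some r -> mulB u s = Some p ->
    exists2 q, mulB x q = Some s & cuts p r q.
  move=> ux us; have [z rz] : exists z, mulB r z = Some p.
    by apply: cyclic_left_factor => //; rewrite (mulB_tgt ux) -(mulB_tgt us) -ep.
  by exists z; [exact: mulB_cancel_l us rz ux | rewrite /cuts rz eqxx].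
have via_right u x r s : mulB x u = Some s -> mulB r u = Some p ->
    exists2 q, mulB q x = Some r & cuts p q s.
  move=> xu ru; have [z zs] : exists z, mulB z s = Some p.
    apply: cyclic_right_factor => //.
    by have [_ -> _] := (mulBP _ _ _).1 xu; have [_ -> _] := (mulBP _ _ _).1 ru.
  by exists z; [exact: mulB_cancel_r ru zs xu | rewrite /cuts zs eqxx].
split=> [u x r s ux|x u r s xu] /cuts_nz cut.
  suff [q xq rq] : exists2 q, mulB x q = Some s & cuts p r q by exists q; rewrite ?rq ?cut.
  case/orP: (cut) => /eqP m; first exact: via_left ux m.
  have [e1 e2 _] := (mulBP _ _ _).1 m; have ts := mulB_tgt m.
  have [f1 f2 _] := (mulBP _ _ _).1 ux.
  have [u0|nu] := eqVneq (word u) [::].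
    apply: (via_left u) => //; have [-> ->] := mulB_trivr size_rel memB m u0.
    by rewrite ep; exact: mul1B.
  have [x0|nx] := eqVneq (word x) [::].
    have [ur ->] := mulB_trivr size_rel memB ux x0; rewrite -ur.
    by exists s => //; rewrite -e2 ep ts; exact: mul1B.
  by rewrite (cyclic_pass cp nu nx) // -?f1 ?e2 in ux.
suff [q qx qs] : exists2 q, mulB q x = Some r & cuts p q s by exists q; rewrite ?qs ?cut.
case/orP: (cut) => /eqP m; first exact: via_right xu m.
have [e1 e2 _] := (mulBP _ _ _).1 m; have tu := mulB_tgt m.
have [f1 f2 _] := (mulBP _ _ _).1 xu.
have [u0|nu] := eqVneq (word u) [::].
  apply: (via_right u) => //; have [-> ->] := mulB_trivl size_rel memB m u0.
  by rewrite -ep; exact: mulB1.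
have [x0|nx] := eqVneq (word x) [::].
  have [us ->] := mulB_trivl size_rel memB xu x0; rewrite -us.
  by exists r => //; rewrite -tu -ep e2; exact: mulB1.
by rewrite (cyclic_pass cp nx nu) // ?f1 -tu in xu.
Qed.

Definition vanishing p q : Prop :=
  [/\ src p = tgt q, src q = tgt p, mulB p q = None /\ mulB q p = None
    & val_at (src p) = 2 /\ val_at (src q) = 2].

Lemma blocked_ends p q : src p = tgt q -> mulB p q = None ->
  exists l h, [/\ last_arrow p = Some l, head_arrow q = Some h & ~~ nzp l h].
Proof.
move=> e m; have [p0|[_ [l [_ lp]]]] := path_ends p.
  by rewrite (word0 size_rel memB p0) e mul1B in m.
have [q0|[h [_ [hq _]]]] := path_ends q.
  have qv : q = vtx (src p) by rewrite e tgtE q0; exact: word0.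
  by rewrite qv mulB1 in m.
by exists l, h; split=> //; rewrite -(mulB_junction size_rel memB lp hq) m.
Qed.

(** At a vertex of valency 2, a nontrivial path to be multiplied with [p] meets it by
    the same arrow as [q] does, and one to be multiplied with [q] by the same arrow
    as [p], so the product vanishes like that of [p] and [q]. *)
Lemma blocked_extend p q x : src p = tgt q -> mulB p q = None ->
  val_at (src p) = 2 ->
  (isSome (mulB p x) -> word x = [::]) /\ (isSome (mulB x q) -> word x = [::]).
Proof.
move=> e m v; have [l [h [lp hq nlh]]] := blocked_ends e m.
have sl := last_arrow_src lp; have th := head_arrow_tgt hq.
have [inh outl] := (val_at2P (etrans th (esym e)) sl).1 v.
have [->|[hx [lx [hhx llx]]]] := path_ends x; first by split.
split.
  case px: (mulB p x) => [r|] // _; have [e1 _ _] := (mulBP _ _ _).1 px.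
  have := mulB_junction size_rel memB lp hhx; rewrite px (inh hx) ?(negPf nlh) //.
  by rewrite (head_arrow_tgt hhx).
case xq: (mulB x q) => [r|] // _; have [e1 _ _] := (mulBP _ _ _).1 xq.
have := mulB_junction size_rel memB llx hq; rewrite xq (outl lx) ?(negPf nlh) //.
by rewrite (last_arrow_src llx) e1.
Qed.

(** Only trivial paths can be moved across such a pair, and these only require the
    paths to be composable. *)
Lemma vanishing_movable (K : fieldType) (c : B -> B -> K) :
  (forall p q, c p q != 0 -> vanishing p q) -> movable c.
Proof.
move=> supp; split=> [u x r s ux|x u r s xu] cn0.
  have [e _ [m _] [v _]] := supp _ _ cn0; have [tx _] := blocked_extend x e m v.
  have [|-> ->] := mulB_trivr size_rel memB ux; first by rewrite tx ?ux.
  exists s => //; have [_ sr _] := (mulBP _ _ _).1 ux.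
  have [|ur _] := mulB_trivr size_rel memB ux; first by rewrite tx ?ux.
  by rewrite -ur e; exact: mul1B.
have [e _ [m _] [v _]] := supp _ _ cn0; have [_ tx] := blocked_extend x e m v.
have [|us xs] := mulB_trivl size_rel memB xu; first by rewrite tx ?xu.
by exists r; rewrite ?us // xs -us -e; exact: mulB1.
Qed.

Section Kernel.
Variables (K : fieldType) (c : B -> B -> K).
Hypothesis connQ : connected_quiver Q.
Hypothesis nondeg : not_degenerate Q.
Hypothesis skew_c : skewsym c.
Hypothesis move_c : movable c.

Let nz_sym p q : c p q != 0 -> c q p != 0.
Proof. by rewrite skew_c oppr_eq0. Qed.

Lemma coef_parallel r s : c r s != 0 -> src r = tgt s /\ src s = tgt r.
Proof.
have half u v : c u v != 0 -> src u = tgt v.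
  move=> /(move_c.1 _ _ _ _ (mulB1 size_rel memB u))[q m _].
  by rewrite (mulB_tgt m).
by move=> rs; split; apply: half => //; exact: nz_sym.
Qed.

Lemma coef_arrows r s a :
  c r s != 0 ->
  (isSome (mulB r (arr1 a)) -> head_arrow s = Some a) /\
  (isSome (mulB (arr1 a) s) -> last_arrow r = Some a).
Proof.
move=> rs; split.
  case m: (mulB r _) => [y|] // _; have [q mq _] := move_c.1 _ _ _ _ m rs.
  exact: head_arrow_mul mq.
case m: (mulB _ s) => [y|] // _; have [q mq _] := move_c.2 _ _ _ _ m rs.
exact: last_arrow_mul mq.
Qed.

Lemma coef_vertex_arrows v s : c (vtx v) s != 0 ->
  (forall a, qtgt a = v -> head_arrow s = Some a) /\
  (forall a, qsrc a = v -> last_arrow s = Some a).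
Proof.
move=> vs; split=> a av.
  apply: (coef_arrows a vs).1.
  by rewrite -av (mul1B size_rel memB (arr1 a)).
apply: (coef_arrows a (nz_sym vs)).2.
by rewrite -av (mulB1 size_rel memB (arr1 a)).
Qed.

(** Moving an arrow that enters [v] shows that it is the arrow by which [s] enters
    [v], and likewise for arrows that leave [v].  If [s] were trivial, no arrow
    would meet [v] and the connected quiver would be a point. *)
Lemma coef_vertex_cyclic v s : c (vtx v) s != 0 -> cyclic s /\ src s = v.
Proof.
move=> vs; have [ts ss] := coef_parallel vs; have [ina outa] := coef_vertex_arrows vs.
split=> //; have [s0|[h [l [hs ls]]]] := path_ends s; last first.
  have sl := last_arrow_src ls; have th := head_arrow_tgt hs.
  split; [by move: hs; rewrite /head_arrow; case: (word s)|by rewrite ss|].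
  apply/(val_at2P (a := h) (b := l)); rewrite ?th ?sl ?ss // .
  split=> a; first by move=> /ina; rewrite hs => -[].
  by move=> /outa; rewrite ls => -[].
have none a : qtgt a != v /\ qsrc a != v.
  by split; apply/eqP; [move/ina | move/outa]; rewrite /head_arrow /last_arrow s0.
have conn_v u : connect (@adjacent Q) v u -> u = v.
  case/connectP=> -[|w t] //= /andP[/existsP[a]].
  by have [/negPf-> /negPf->] := none a; rewrite andbF.
case: nondeg; split.
  apply/eqP; rewrite -cardsT; apply/cards1P; exists v.
  by apply/setP=> u; rewrite !inE (conn_v u) ?eqxx.
rewrite -cardsT; suff -> : [set: arrow Q] = set0 by rewrite cards0.
apply/setP=> a; rewrite !inE; have [_] := none a.
by rewrite (conn_v (qsrc a)) ?eqxx.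
Qed.

(** The whole of [s] is moved from one argument to the other. *)
Lemma coef_vertex_sym v s : c (vtx v) s != 0 -> c s (vtx v) = c (vtx v) s.
Proof.
move=> vs; have [[_ es _] sv] := coef_vertex_cyclic vs.
have m : mulB (vtx v) s = Some s by rewrite -sv es; exact: mul1B.
have [q sq <-] := move_c.1 _ _ _ _ m vs.
by rewrite (mulB_id_r size_rel memB sq) sv.
Qed.

Hypothesis coef_diag : forall p, cyclic p -> c p p = 0.
Hypothesis coef_cyclic : forall p, cyclic p -> c p (vtx (src p)) = 0.
Hypothesis coef_vanishing : forall p q, p != q -> vanishing p q -> c p q = 0.

(** An entry at a trivial path is an entry at a cycle and its vertex, by
    [coef_vertex_cyclic]. *)
Let coef_word0 p q : c p q != 0 -> word p != [::].
Proof.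
move=> pq; apply/eqP => p0; rewrite (word0 size_rel memB p0) in pq.
have [cq sq] := coef_vertex_cyclic pq.
by have := nz_sym pq; rewrite -sq coef_cyclic ?eqxx.
Qed.

(** If the product were nonzero, moving [q] entirely would leave a nonzero entry at
    a trivial path. *)
Let coef_mul p q : c p q != 0 -> mulB p q = None.
Proof.
move=> pq; case m: (mulB p q) => [y|] //.
have [z qz yz] := move_c.1 _ _ _ _ m pq.
have : c z y != 0 by apply: nz_sym; rewrite yz.
by move/coef_word0; rewrite (mulB_id_r size_rel memB qz).
Qed.

(** An arrow at the common endpoint of [p] and [q], other than their own, has a
    nonzero product with one of them, since the junction of [p] and [q] already
    uses up the only relation available; so it can be moved, which makes it an end
    of the other path. *)
Let coef_val p q : c p q != 0 -> val_at (src p) = 2.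
Proof.
move=> pq; have [e _] := coef_parallel pq.
have [l [h [lp hq nlh]]] := blocked_ends e (coef_mul pq).
have sl := last_arrow_src lp; have th := head_arrow_tgt hq.
apply/(val_at2P (etrans th (esym e)) sl); split=> a av.
  have [la|nla] := boolP (nzp l a); last first.
    by apply: rel_next nla _ nlh; rewrite ?sl ?av ?th.
  have /(coef_arrows a pq).1 : isSome (mulB p (arr1 a)).
    by rewrite (mulB_junction size_rel memB lp (head_arrow_arr size_rel memB a)).
  by rewrite hq => -[].
have [ah|nah] := boolP (nzp a h); last first.
  by apply: rel_prev nah _ nlh; rewrite ?sl ?av ?th.
have /(coef_arrows a pq).2 : isSome (mulB (arr1 a) q).
  by rewrite (mulB_junction size_rel memB (last_arrow_arr size_rel memB a) hq).
by rewrite lp => -[].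
Qed.

Lemma coef_kernel p q : c p q = 0.
Proof.
apply/eqP; apply: contraT => pq; have qp := nz_sym pq.
have [e1 e2] := coef_parallel pq.
have [epq|npq] := eqVneq p q.
  have cp : cyclic p.
    by split; [exact: coef_word0 pq | rewrite {1}e1 epq | exact: coef_val pq].
  by move: pq; rewrite -epq coef_diag ?eqxx.
have vpq : vanishing p q.
  by split=> //; split; rewrite ?(coef_mul pq, coef_mul qp, coef_val pq, coef_val qp).
by move: pq; rewrite coef_vanishing ?eqxx.
Qed.

End Kernel.

End GentleCombinatorics.

(** * A basis from a dual family *)

(** The functionals [lam] show independence.  Subtracting from [v] the combination
    of the [F i] with coefficients [lam i v] gives a vector of [P] on which all of
    them vanish, which shows generation. *)
Lemma basis_of_dual_family (K : fieldType) (V : vectType K) (T : eqType)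
    (s : seq T) (F : T -> V) (lam : T -> V -> K) (P : V -> Prop) :
  uniq s ->
  (forall t a v w, lam t (a *: v + w) = a * lam t v + lam t w) ->
  {in s &, forall i j, lam i (F j) = (i == j)%:R} ->
  P 0 -> (forall a v w, P v -> P w -> P (a *: v + w)) ->
  {in s, forall i, P (F i)} ->
  (forall v, P v -> {in s, forall i, lam i v = 0} -> v = 0) ->
  is_basis (map F s) P.
Proof.
move=> us lamL dual P0 PL PF ker.
have lam0 t : lam t 0 = 0.
  have := lamL t (-1) 0 0; rewrite scaler0 addr0 => ->.
  by rewrite mulN1r addNr.
have lam_sum (J : Type) (r : seq J) t (k : J -> K) (v : J -> V) :
    lam t (\sum_(j <- r) k j *: v j) = \sum_(j <- r) k j * lam t (v j).
  elim: r => [|j r IH]; first by rewrite !big_nil lam0.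
  by rewrite !big_cons lamL IH.
have P_sum (J : eqType) (r : seq J) (k : J -> K) (v : J -> V) :
    {in r, forall j, P (v j)} -> P (\sum_(j <- r) k j *: v j).
  elim: r => [|j r IH] Pv; first by rewrite big_nil.
  rewrite big_cons; apply: PL; first by apply: Pv; rewrite mem_head.
  by apply: IH => i ir; apply: Pv; rewrite inE ir orbT.
pose X := map_tuple F (in_tuple s).
have X_nth (i : 'I_(size s)) : X`_i = F (tnth (in_tuple s) i) by rewrite -tnth_nth tnth_map.
exists <<map F s>>%VS; last first.
  rewrite /basis_of eqxx /=; apply/(@freeP _ _ _ X) => k sk i.
  have := congr1 (lam (tnth (in_tuple s) i)) sk; rewrite lam_sum lam0.
  rewrite (bigD1 i) //= big1 => [|j ji]; rewrite X_nth dual ?mem_tnth //.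
    by rewrite eqxx mulr1 addr0.
  have /tuple_uniqP inj := us : uniq (in_tuple s).
  by rewrite (inj_eq inj) eq_sym (negPf ji) mulr0.
move=> v; split=> [vX|Pv].
  rewrite (@coord_span _ _ _ X v vX); apply: P_sum => i _; rewrite X_nth.
  by apply: PF; exact: mem_tnth.
pose w := \sum_(i <- s) lam i v *: F i.
have Pw : P w by exact: P_sum.
have dw : {in s, forall i, lam i w = lam i v}.
  move=> i si; rewrite lam_sum (bigD1_seq i) //= dual // eqxx mulr1.
  rewrite big_seq_cond big1 ?addr0 // => j /andP[sj ji].
  by rewrite dual // eq_sym (negPf ji) mulr0.
(* The remainder [v - w] is annihilated by every functional of the family. *)
have := ker (-1 *: w + v) (PL _ _ _ Pw Pv).
rewrite scaleN1r addrC => /(_ _)/eqP; rewrite subr_eq0 => /(_ _)/eqP -> //.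
  rewrite /w big_seq; apply: rpred_sum => i si; apply: rpredZ.
  by apply: memv_span; exact: map_f.
by move=> i si; rewrite -addrC -scaleN1r lamL mulN1r dw // addNr.
Qed.

Lemma eq_opp_eq0 (K : fieldType) (x : K) : 2%N \notin [pchar K] -> x = - x -> x = 0.
Proof.
rewrite inE /= => n2 /eqP; rewrite -subr_eq0 opprK -mulr2n -mulr_natl mulf_eq0.
by rewrite (negPf n2) => /eqP.
Qed.

(** * The basis of alternating maps *)

Section GentleAlt.
Variables (K : fieldType) (Q : quiver) (I : pathAlg K Q -> Prop).
Variables (R : qpath Q -> Prop) (A : falgType K).
Variables (pi : {lrmorphism pathAlg K Q -> A}) (B : {fset qpath Q}).
Variable (S : {set B * B}).
Hypothesis gentleI : gentle I.
Hypothesis nondeg : not_degenerate Q.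
Hypothesis presI : presentation I pi.
Hypothesis genI : quadratic_gen I R.
Hypothesis memB : forall p, p \in B <-> relation_free R p.
Hypothesis choiceS : pair_choice I S.
Implicit Types (p q r s x y z : B).

Let size_rel := genI.1.
Local Notation nzp := (nonzero_pair B).
Local Notation vtx := (vtxB size_rel memB).

Let gentle_next (a b b' : arrow Q) : nzp a b -> nzp a b' -> b = b'.
Proof.
move=> ab ab'; have [_ _ /(_ a)[h _] _ _] := gentleI.
have e := nonzero_pair_src ab; have e' := nonzero_pair_src ab'.
by apply: h => // /(ideal_arr presI genI memB); rewrite ?ab ?ab' => /(_ _)/negP h; apply: h.
Qed.

Let gentle_prev (a b b' : arrow Q) : nzp b a -> nzp b' a -> b = b'.
Proof.
move=> ab ab'; have [_ _ /(_ a)[_ h] _ _] := gentleI.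
have e := nonzero_pair_src ab; have e' := nonzero_pair_src ab'.
by apply: h => // /(ideal_arr presI genI memB); rewrite ?ab ?ab' => /(_ _)/negP h; apply: h.
Qed.

Let gentle_rel_next (a b b' : arrow Q) : qsrc a = qtgt b -> ~~ nzp a b ->
  qsrc a = qtgt b' -> ~~ nzp a b' -> b = b'.
Proof.
move=> e n e' n'; have [_ _ _ /(_ a)[h _] _] := gentleI.
by apply: h => //; apply/(ideal_arr presI genI memB).
Qed.

Let gentle_rel_prev (a b b' : arrow Q) : qsrc b = qtgt a -> ~~ nzp b a ->
  qsrc b' = qtgt a -> ~~ nzp b' a -> b = b'.
Proof.
move=> e n e' n'; have [_ _ _ /(_ a)[_ h] _] := gentleI.
by apply: h => //; apply/(ideal_arr presI genI memB).
Qed.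

Lemma good_pairE p q : good_pair I p q <-> p != q /\ vanishing p q.
Proof.
split=> [[n [i1 i2] [e1 e2] v]|[n [e1 e2 [m1 m2] v]]].
  by split=> //; split=> //; split; apply/(ideal_mul_pelt presI genI memB).
by split=> //; split; apply/(ideal_mul_pelt presI genI memB).
Qed.

Lemma good_cycleE p : reflect (cyclic p) (good_cycle p).
Proof.
apply: (iffP and3P) => -[n e v]; split; try exact/eqP.
  by rewrite -size_eq0 -lt0n.
by rewrite /plength lt0n size_eq0.
Qed.

Lemma cyclic_sq p : cyclic p -> mulB p p = None.
Proof.
by move=> cp; have [n e _] := cp; apply: (cyclic_pass size_rel memB cp).
Qed.

Lemma cyclic_vanishing p : cyclic p -> vanishing p p.
Proof. by move=> cp; have [n e v] := cp; split; rewrite ?cyclic_sq. Qed.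

Lemma chosenP p q : (p, q) \in S -> [/\ p != q, vanishing p q & (q, p) \notin S].
Proof.
move=> pq; have gpq := choiceS.1 p q pq; have [n v] := (good_pairE p q).1 gpq.
by split=> //; have := choiceS.2 _ _ gpq; rewrite pq.
Qed.

Lemma chosen_or p q : p != q -> vanishing p q -> (p, q) \in S \/ (q, p) \in S.
Proof.
move=> n v; have /choiceS.2 : good_pair I p q by apply/good_pairE.
by case: ((p, q) \in S); [left|right].
Qed.

Lemma coef_phi p q a b : p != q -> coef pi (phi pi p q) a b
  = ((a == p) && (b == q))%:R - ((a == q) && (b == p))%:R.
Proof.
move=> n; rewrite (coef_on_dual_basis presI genI memB).
have dd := dvec_delta presI genI memB.
have [->|na] := eqVneq a p; first by rewrite dd (negPf n) subr0.
by case: (a == q); rewrite /= ?linearN ?linear0 /= ?dd ?sub0r ?subr0 ?oppr0.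
Qed.

Lemma coef_psi_e p a b : cyclic p -> coef pi (psi_e pi p) a b = (cuts p a b)%:R.
Proof.
move=> cp; rewrite (coef_on_dual_basis presI genI memB).
have dd := dvec_delta presI genI memB.
have cutsE x y : (qcomp (val x) (val y) == Some (val p))
    || (qcomp (val y) (val x) == Some (val p)) = cuts p x y.
  by rewrite /cuts; congr (_ || _); apply/eqP/eqP => /mulBE.
case: pickP => [r|no] /=; last by rewrite linear0 -cutsE no.
rewrite cutsE => ar; rewrite dd; congr (nat_of_bool _)%:R.
apply/eqP/idP => [->//|ab].
exact: (cuts_functional size_rel memB cp ab ar).
Qed.

Lemma coef_psi_p p a b : coef pi (psi_p pi p) a b = ((a == p) && (b == p))%:R.
Proof.
rewrite (coef_on_dual_basis presI genI memB).
by case: (a == p); rewrite ?linear0 // (dvec_delta presI genI memB).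
Qed.

Lemma phi_Alt p q : p != q -> vanishing p q -> Alt (phi pi p q).
Proof.
move=> n [e1 e2 [m1 m2] [v1 v2]]; apply/(Alt_coef presI genI memB); split=> [a b|].
  by rewrite !coef_phi // opprB andbC [in X in _ - X]andbC.
apply/balancedP/(vanishing_movable size_rel memB) => a b; rewrite coef_phi //.
case: andP => [[/eqP-> /eqP->] _|_]; first by split.
by case: andP => [[/eqP-> /eqP->] _|_]; [split|rewrite subr0 eqxx].
Qed.

Lemma psi_e_Alt p : 2%N \in [pchar K] -> cyclic p -> Alt (psi_e pi p).
Proof.
move=> K2 cp; apply/(Alt_coef presI genI memB); split=> [a b|].
  by rewrite !coef_psi_e // oppr_pchar2 // cutsC.
apply/balancedP; have [h1 h2] := cuts_movable size_rel memB gentle_next gentle_prev K cp.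
have e a b := coef_psi_e a b cp.
split=> [u x r s ux|x u r s xu]; rewrite e => cut.
  by have [q m h] := h1 _ _ _ _ ux cut; exists q; rewrite ?e.
by have [q m h] := h2 _ _ _ _ xu cut; exists q; rewrite ?e.
Qed.

Lemma psi_p_Alt p : 2%N \in [pchar K] -> cyclic p -> Alt (psi_p pi p).
Proof.
move=> K2 cp; apply/(Alt_coef presI genI memB); split=> [a b|].
  by rewrite !coef_psi_p oppr_pchar2 // andbC.
apply/balancedP/(vanishing_movable size_rel memB) => a b; rewrite coef_psi_p.
case: andP => [[/eqP-> /eqP->] _|_]; last by rewrite eqxx.
exact: cyclic_vanishing.
Qed.

Lemma Alt0 : Alt (0 : 'Hom('Hom(A, K^o), A)).
Proof.
split=> [x f y|f g]; first by rewrite !zero_lfunE mulr0 mul0r.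
apply/lfunP => z; rewrite add_lfunE !bimodE !zero_lfunE.
by rewrite !(mul0r, mulr0) !linear0 addr0.
Qed.

Lemma AltD a (u v : 'Hom('Hom(A, K^o), A)) : Alt u -> Alt v -> Alt (a *: u + v).
Proof.
move=> /(Alt_coef presI genI memB)[s1 b1] /(Alt_coef presI genI memB)[s2 b2].
apply/(Alt_coef presI genI memB); split=> [p q|x r s].
  by rewrite !coef_linear s1 s2 mulrN opprD.
under eq_bigr => p _ do rewrite coef_linear mulrDr mulrCA.
under [RHS]eq_bigr => p _ do rewrite coef_linear mulrDr mulrCA.
by rewrite !big_split /= -!mulr_sumr b1 b2.
Qed.

Local Notation index := ((B * B) + (B + B))%type.

(** The three families of maps under one index type, so that the duality with the
    matrix entries can be stated at once. *)
Definition alt_map (t : index) : 'Hom('Hom(A, K^o), A) :=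
  match t with
  | inl x => phi pi x.1 x.2
  | inr (inl p) => psi_e pi p
  | inr (inr p) => psi_p pi p
  end.

(** For each map, an entry of its matrix at which the other maps vanish. *)
Definition alt_entry (t : index) : B * B :=
  match t with
  | inl x => x
  | inr (inl p) => (p, vtx (src p))
  | inr (inr p) => (p, p)
  end.

Definition admissible (t : index) : Prop :=
  match t with inl x => x \in S | inr (inl p) | inr (inr p) => cyclic p end.

Lemma alt_entry_dual i j : admissible i -> admissible j ->
  coef pi (alt_map j) (alt_entry i).1 (alt_entry i).2 = (i == j)%:R.
Proof.
case: i => [[p' q']|[p'|p']]; case: j => [[p q]|[p|p]] /= ai aj.
- have [n v nqp] := chosenP aj; rewrite coef_phi //.
  suff -> : (p' == q) && (q' == p) = false by rewrite subr0.
  by apply/negP => /andP[/eqP e1 /eqP e2]; rewrite -e1 -e2 ai in nqp.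
- by have [_ [_ _ [m1 m2] _] _] := chosenP ai; rewrite coef_psi_e // /cuts m1 m2.
- have [n _ _] := chosenP ai; rewrite coef_psi_p.
  by case: (p' =P p) => //= <-; rewrite eq_sym (negPf n).
- have [n [e1 e2 [m1 m2] _] _] := chosenP aj; rewrite coef_phi //.
  have [m3 m4] : mulB p' (vtx (src p')) != None /\ mulB (vtx (src p')) p' != None.
    by have [_ e _] := ai; rewrite mulB1 e mul1B.
  case: (p' =P p) => [ep|_]; case: (p' =P q) => [eq|_]; rewrite ?subr0 //=.
  - by rewrite -ep -eq eqxx in n.
  - by case: eqP => [ev|_]; rewrite ?subr0 //; rewrite ev ep m1 in m3.
  by case: eqP => [ev|_]; rewrite ?subr0 //; rewrite ev eq m1 in m4.
- rewrite coef_psi_e // /cuts mulB1; have [_ -> _] := ai.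
  by rewrite mul1B orbb.
- rewrite coef_psi_p; case: eqP => //= _; case: eqP => // ep.
  by have [] := aj; rewrite -ep.
- have [n _ _] := chosenP aj; rewrite coef_phi //.
  by case: (p' =P p) => [->|_]; rewrite ?(negPf n) /= ?andbF ?subr0.
- by rewrite coef_psi_e // /cuts cyclic_sq.
by rewrite coef_psi_p andbb.
Qed.

Lemma alt_map_Alt t : (~~ is_inl t -> 2%N \in [pchar K]) ->
  admissible t -> Alt (alt_map t).
Proof.
case: t => [[p q]|[p|p]] /=.
- by move=> _ /chosenP[n v _]; exact: phi_Alt.
- by move=> /(_ isT); exact: psi_e_Alt.
by move=> /(_ isT); exact: psi_p_Alt.
Qed.

Lemma alt_determined (psi : 'Hom('Hom(A, K^o), A)) : Alt psi ->
  (forall p q, (p, q) \in S -> coef pi psi p q = 0) ->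
  (forall p, cyclic p -> coef pi psi p p = 0) ->
  (forall p, cyclic p -> coef pi psi p (vtx (src p)) = 0) -> psi = 0.
Proof.
move=> /(Alt_coef presI genI memB)[sk /balancedP mv] zS zd zc.
have [connQ _ _ _ _] := gentleI.
apply: (coef_eq0 presI genI memB) => p q.
apply: (coef_kernel gentle_rel_next gentle_rel_prev connQ nondeg sk mv zd zc).
move=> {}p {}q n v; have [/zS //|qp] := chosen_or n v.
by rewrite sk zS ?oppr0.
Qed.

(** Both entries are equal to their opposites: the first by skew-symmetry alone,
    the second because moving [p] exchanges its two arguments. *)
Lemma alt_odd_diag (psi : 'Hom('Hom(A, K^o), A)) : 2%N \notin [pchar K] -> Alt psi ->
  (forall p, cyclic p -> coef pi psi p p = 0) /\
  (forall p, cyclic p -> coef pi psi p (vtx (src p)) = 0).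
Proof.
move=> K2 /(Alt_coef presI genI memB)[sk /balancedP mv].
have [connQ _ _ _ _] := gentleI.
split=> p cp; apply: eq_opp_eq0 => //.
have [p0|pv] := eqVneq (coef pi psi p (vtx (src p))) 0; first by rewrite p0 oppr0.
rewrite {1}(coef_vertex_sym connQ nondeg sk mv) //.
by rewrite sk oppr_eq0.
Qed.

Definition alt_indices : seq index := [seq inl u | u <- enum S]
  ++ [seq inr (inl p) | p : B <- enum {: B} & good_cycle p]
  ++ [seq inr (inr p) | p : B <- enum {: B} & good_cycle p].

Lemma mem_alt_indices t : t \in alt_indices -> admissible t.
Proof.
rewrite !mem_cat => /or3P[]/mapP[x].
- by rewrite mem_enum => xS ->.
- by rewrite mem_filter => /andP[/good_cycleE cx _] ->.
by rewrite mem_filter => /andP[/good_cycleE cx _] ->.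
Qed.

Lemma alt_indices_uniq : uniq alt_indices.
Proof.
rewrite !cat_uniq !map_inj_uniq; try by move=> x y [].
rewrite enum_uniq filter_uniq ?enum_uniq //= andbT.
apply/andP; split; apply/hasPn => t; rewrite ?mem_cat.
  by case/orP=> /mapP[x _ ->]; apply/mapP=> -[].
by case/mapP=> x _ ->; apply/mapP=> -[].
Qed.

Lemma alt_basis_subfamily (s : seq index) : uniq s ->
  {in s, forall t, admissible t /\ (~~ is_inl t -> 2%N \in [pchar K])} ->
  (forall psi : 'Hom('Hom(A, K^o), A), Alt psi ->
    {in s, forall t, coef pi psi (alt_entry t).1 (alt_entry t).2 = 0} -> psi = 0) ->
  is_basis (map alt_map s) (@Alt K A).
Proof.
move=> us sP ker.
apply: (basis_of_dual_family
  (lam := fun t psi => coef pi psi (alt_entry t).1 (alt_entry t).2)) => //.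
- by move=> t a v w; exact: coef_linear.
- by move=> i j /sP[ai _] /sP[aj _]; exact: alt_entry_dual.
- exact: Alt0.
- exact: AltD.
by move=> t /sP[at_ kt]; exact: alt_map_Alt.
Qed.

Lemma alt_basis_odd : 2%N \notin [pchar K] ->
  is_basis [seq phi pi u.1 u.2 | u <- enum S] (@Alt K A).
Proof.
move=> K2; have -> : [seq phi pi u.1 u.2 | u <- enum S]
    = map alt_map [seq inl u | u <- enum S] by rewrite -map_comp.
apply: alt_basis_subfamily.
- by rewrite map_inj_uniq ?enum_uniq // => x y [].
- by move=> _ /mapP[x xS ->]; split=> //=; rewrite -mem_enum.
move=> psi alt z; have [zd zc] := alt_odd_diag K2 alt.
apply: alt_determined => // p q pq; apply: (z (inl (p, q))).
by apply: map_f; rewrite mem_enum.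
Qed.

Lemma alt_basis_two : 2%N \in [pchar K] ->
  is_basis ([seq phi pi u.1 u.2 | u <- enum S]
            ++ [seq psi_e pi p | p : B <- enum {: B} & good_cycle p]
            ++ [seq psi_p pi p | p : B <- enum {: B} & good_cycle p])
           (@Alt K A).
Proof.
move=> K2; have e : map alt_map alt_indices = [seq phi pi u.1 u.2 | u <- enum S]
    ++ [seq psi_e pi p | p : B <- enum {: B} & good_cycle p]
    ++ [seq psi_p pi p | p : B <- enum {: B} & good_cycle p].
  by rewrite !map_cat -!map_comp.
rewrite -e; apply: alt_basis_subfamily; first exact: alt_indices_uniq.
  by move=> t /mem_alt_indices.
have cyc_mem p : cyclic p -> p \in [seq p <- enum {: B} | good_cycle p].
  by move=> /good_cycleE cp; rewrite mem_filter cp mem_enum.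
move=> psi alt z; apply: alt_determined => // [p q pq|p cp|p cp].
- by apply: (z (inl (p, q))); rewrite mem_cat map_f ?mem_enum.
- by apply: (z (inr (inr p))); rewrite !mem_cat [X in _ || X]orbC map_f ?orbT // cyc_mem.
by apply: (z (inr (inl p))); rewrite !mem_cat map_f ?orbT // cyc_mem.
Qed.

End GentleAlt.

Theorem theorem3p21 (K : fieldType) (Q : quiver) (I : pathAlg K Q -> Prop)
    (R : qpath Q -> Prop) (A : falgType K)
    (pi : {lrmorphism pathAlg K Q -> A}) (B : {fset qpath Q})
    (S : {set B * B}) :
  gentle I -> not_degenerate Q -> presentation I pi ->
  minimal_quadratic_gen I R ->
  (forall p, p \in B <-> relation_free R p) ->
  pair_choice I S ->
  (2%N \notin [pchar K] ->
     is_basis [seq phi pi x.1 x.2 | x <- enum S] (@Alt K A)) /\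
  (2%N \in [pchar K] ->
     is_basis ([seq phi pi x.1 x.2 | x <- enum S]
               ++ [seq psi_e pi p | p : B <- enum {: B} & good_cycle p]
               ++ [seq psi_p pi p | p : B <- enum {: B} & good_cycle p])
              (@Alt K A)).
Proof.
move=> gI nd pr [gen _] mB ch; split.
  exact: (alt_basis_odd gI nd pr gen mB ch).
exact: (alt_basis_two gI nd pr gen mB ch).
Qed.
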